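(* Let $W=G_{26}$. The algebra $\mathrm{Br}(W)$ is a free $\mathcal A$-module, and the set $\{we_H\mid H\in\mathcal H,\ w\in W/W_H\}$ is a basis, where $W_H$ is the pointwise stabilizer of $H$ in $W$ and $W/W_H$ denotes a set of left coset representatives of $W_H$ in $W$.
   Context: The group $G_{26}$. Let $z_1,z_2,z_3$ be the standard coordinates of $\mathbb C^3$ (with the standard inner product) and $\zeta=e^{2\pi i/3}$. $G_{26}\subseteq GL(\mathbb C^3)$ is the group generated by the unitary reflections: of order $3$ with hyperplanes $z_i=0$ ($i=1,2,3$); of order $3$ with hyperplanes $z_1+\zeta^\kappa z_2+\zeta^\lambda z_3=0$ ($\kappa,\lambda\in\{0,1,2\}$); of order $2$ with hyperplanes $z_i=\zeta^\kappa z_j$ ($1\le i\ne j\le3$, $\kappa\in\{0,1,2\}$). Notation. Write $V_W=\mathbb C^3$. A reflection of $V_W$ is an $r\in GL(V_W)$ such that $H_r:=\ker(r-1)$ has codimension $1$; $H_r$ is its reflecting hyperplane. $\mathcal R$ is the set of reflections in $W\subseteq GL(V_W)$ and $\mathcal H$ the set of their reflecting hyperplanes. $W$ acts on $\mathcal H$ by $wH=w(H)$ and on $\mathcal R$ by conjugation; $\sim$ denotes conjugacy. $\mathcal R_{a\to b}$ is the set of $s\in\mathcal R$ with $sa=b$. Distinct $H_1,H_2\in\mathcal H$ are transverse, $H_1\pitchfork H_2$, if they are the only elements of $\mathcal H$ containing $H_1\cap H_2$; $H_1\not\pitchfork H_2$ means distinct and not transverse. Brauer-Chen algebra. Let $\delta,\mu_s$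 ($s\in\mathcal R$) be indeterminates, $\underline\mu=\{\mu_s\mid s\in\mathcal R\}$, and $\mathcal A=\mathbb Z[\underline\mu^{\pm1},\delta^{\pm1}]/(\mu_s-\mu_{s'}\mid s\sim s')$. $\mathrm{Br}(W)$ is the $\mathcal A$-algebra generated by the elements of $W$ (with the group relations) and elements $e_H$, $H\in\mathcal H$, with relations, for $H,H_1,H_2\in\mathcal H$ and $w\in W$: (B1) $e_H^2=\delta e_H$; (B2) $we_Hw^{-1}=e_{wH}$; (B3) $we_H=e_H$ if $H\subseteq\ker(w-1)$; (B4) $e_{H_1}e_{H_2}=e_{H_2}e_{H_1}$ if $H_1\pitchfork H_2$; (B5) $e_{H_1}e_{H_2}=\sum_{s\in\mathcal R_{H_2\to H_1}}\mu_s s\,e_{H_2}$ if $H_1\not\pitchfork H_2$.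
   Formalization: The elements of W are added to the basis: the formal claim is that W together with {we_H} is a basis of Br(W). The set {we_H} alone cannot span, since e_H ↦ 0, w ↦ w defines a surjection Br(W) → A[W] killing every we_H but not 1. *)

(* Defs.v *)
From HB Require Import structures.
From mathcomp Require Import all_boot all_order all_algebra.
From mathcomp Require Import boolp classical_sets reals trigo.
From mathcomp Require Import complex.

Set Implicit Arguments.
Unset Strict Implicit.
Unset Printing Implicit Defensive.

Import GRing.Theory.

Local Open Scope classical_set_scope.
Local Open Scope quotient_scope.
Local Open Scope ring_scope.

(** * Associative unital algebras given by generators and relations *)

(** [expr R X] are the formal noncommutative polynomial expressions in the
    generators [X] with coefficients in [R]; [pcong gr] is the smallest
    congruence containing [gr] and the axioms of an associative unital
    [R]-algebra, with [a *: x] written [Const a * x].  Thus [presalg gr] is the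
    quotient of the free algebra on [X] by the two-sided ideal generated by the
    [x - y] with [gr x y]. *)
Inductive expr (R X : Type) : Type :=
| Const of R
| Gen of X
| Add of expr R X & expr R X
| Mul of expr R X & expr R X.

Arguments Const {R X}.
Arguments Gen {R X}.

HB.instance Definition _ R X := gen_eqMixin (expr R X).
HB.instance Definition _ R X := gen_choiceMixin (expr R X).

Declare Scope expr_scope.
Delimit Scope expr_scope with X.
Notation "x + y" := (Add x y) : expr_scope.
Notation "x * y" := (Mul x y) : expr_scope.
Notation "0" := (Const 0) : expr_scope.
Notation "1" := (Const 1) : expr_scope.

Section Presentation.
Variables (R : comPzRingType) (X : Type) (gr : expr R X -> expr R X -> Prop).

Inductive pcong : expr R X -> expr R X -> Prop :=
| pc_rel x y of gr x y : pcong x y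
| pc_refl x : pcong x x
| pc_sym x y of pcong x y : pcong y x
| pc_trans x y z of pcong x y & pcong y z : pcong x z
| pc_add x x' y y' of pcong x x' & pcong y y' : pcong (x + y)%X (x' + y')%X
| pc_mul x x' y y' of pcong x x' & pcong y y' : pcong (x * y)%X (x' * y')%X
| pc_addA x y z : pcong (x + (y + z))%X ((x + y) + z)%X
| pc_addC x y : pcong (x + y)%X (y + x)%X
| pc_add0 x : pcong (0 + x)%X x
| pc_addN x : pcong (Const (-1) * x + x)%X 0%X
| pc_mulA x y z : pcong (x * (y * z))%X ((x * y) * z)%X
| pc_mul1l x : pcong (1 * x)%X x
| pc_mul1r x : pcong (x * 1)%X x
| pc_mulDl x y z : pcong ((x + y) * z)%X (x * z + y * z)%X
| pc_mulDr x y z : pcong (x * (y + z))%X (x * y + x * z)%X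
| pc_constD a b : pcong (Const (a + b)) (Const a + Const b)%X
| pc_constM a b : pcong (Const (a * b)) (Const a * Const b)%X
| pc_constC a x : pcong (Const a * x)%X (x * Const a)%X.

Definition pcongb : rel (expr R X) := fun x y => `[< pcong x y >].

Lemma pcongb_refl : reflexive pcongb.
Proof. by move=> x; apply/asboolP; exact: pc_refl. Qed.

Lemma pcongb_sym : symmetric pcongb.
Proof.
by move=> x y; apply/asboolP/asboolP => h; exact: pc_sym h.
Qed.

Lemma pcongb_trans : transitive pcongb.
Proof.
by move=> y x z /asboolP h /asboolP k; apply/asboolP; exact: pc_trans h k.
Qed.

Canonical pcong_equiv := EquivRel pcongb pcongb_refl pcongb_sym pcongb_trans.

Definition presalg := {eq_quot pcong_equiv}.

HB.instance Definition _ := Choice.on presalg.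

Definition cls (x : expr R X) : presalg := \pi_presalg x.

Lemma clsP x y : cls x = cls y <-> pcong x y.
Proof.
split => [/eqmodP/asboolP //|h].
by apply/eqmodP/asboolP.
Qed.

Lemma cls_surj (u : presalg) : exists x, u = cls x.
Proof. by exists (repr u); rewrite /cls reprK. Qed.

Definition pzero : presalg := cls 0%X.
Definition pone : presalg := cls 1%X.
Definition padd (u v : presalg) : presalg := cls (repr u + repr v)%X.
Definition pmul (u v : presalg) : presalg := cls (repr u * repr v)%X.
Definition popp (u : presalg) : presalg := cls (Const (-1) * repr u)%X.
Definition pscale (a : R) (u : presalg) : presalg := cls (Const a * repr u)%X.

Lemma repr_cls x : pcong (repr (cls x)) x.
Proof. by apply/clsP; rewrite /cls reprK. Qed.

Lemma paddE x y : padd (cls x) (cls y) = cls (x + y)%X.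
Proof. by apply/clsP; apply: pc_add; exact: repr_cls. Qed.
Lemma pmulE x y : pmul (cls x) (cls y) = cls (x * y)%X.
Proof. by apply/clsP; apply: pc_mul; exact: repr_cls. Qed.
Lemma poppE x : popp (cls x) = cls (Const (-1) * x)%X.
Proof. by apply/clsP; apply: pc_mul (pc_refl _) _; exact: repr_cls. Qed.
Lemma pscaleE a x : pscale a (cls x) = cls (Const a * x)%X.
Proof. by apply/clsP; apply: pc_mul (pc_refl _) _; exact: repr_cls. Qed.

Lemma paddA : associative padd.
Proof.
move=> u v w; have [x ->] := cls_surj u; have [y ->] := cls_surj v.
have [z ->] := cls_surj w; rewrite !paddE; apply/clsP; exact: pc_addA.
Qed.
Lemma paddC : commutative padd.
Proof.
move=> u v; have [x ->] := cls_surj u; have [y ->] := cls_surj v.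
rewrite !paddE; apply/clsP; exact: pc_addC.
Qed.
Lemma padd0 : left_id pzero padd.
Proof.
move=> u; have [x ->] := cls_surj u.
rewrite paddE; apply/clsP; exact: pc_add0.
Qed.
Lemma paddN : left_inverse pzero popp padd.
Proof.
move=> u; have [x ->] := cls_surj u.
rewrite poppE paddE; apply/clsP; exact: pc_addN.
Qed.

HB.instance Definition _ := GRing.isZmodule.Build presalg paddA paddC padd0 paddN.

Lemma pmulA : associative pmul.
Proof.
move=> u v w; have [x ->] := cls_surj u; have [y ->] := cls_surj v.
have [z ->] := cls_surj w; rewrite !pmulE; apply/clsP; exact: pc_mulA.
Qed.
Lemma pmul1l : left_id pone pmul.
Proof.
move=> u; have [x ->] := cls_surj u.
rewrite pmulE; apply/clsP; exact: pc_mul1l.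
Qed.
Lemma pmul1r : right_id pone pmul.
Proof.
move=> u; have [x ->] := cls_surj u.
rewrite pmulE; apply/clsP; exact: pc_mul1r.
Qed.
Lemma pmulDl : left_distributive pmul padd.
Proof.
move=> u v w; have [x ->] := cls_surj u; have [y ->] := cls_surj v.
have [z ->] := cls_surj w; rewrite !(pmulE, paddE); apply/clsP; exact: pc_mulDl.
Qed.
Lemma pmulDr : right_distributive pmul padd.
Proof.
move=> u v w; have [x ->] := cls_surj u; have [y ->] := cls_surj v.
have [z ->] := cls_surj w; rewrite !(pmulE, paddE); apply/clsP; exact: pc_mulDr.
Qed.

HB.instance Definition _ :=
  GRing.Zmodule_isPzRing.Build presalg pmulA pmul1l pmul1r pmulDl pmulDr.

Lemma pscaleA a b v : pscale a (pscale b v) = pscale (a * b) v.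
Proof.
have [x ->] := cls_surj v; rewrite !pscaleE; apply/clsP.
exact: pc_trans (pc_mulA _ _ _) (pc_mul (pc_sym (pc_constM _ _)) (pc_refl _)).
Qed.
Lemma pscale1 : left_id 1 pscale.
Proof.
move=> v; have [x ->] := cls_surj v; rewrite pscaleE; apply/clsP.
exact: pc_mul1l.
Qed.
Lemma pscaleDr : right_distributive pscale +%R.
Proof.
move=> a u v; have [x ->] := cls_surj u; have [y ->] := cls_surj v.
rewrite -[X in pscale _ X]/(padd _ _) -[RHS]/(padd _ _) !(pscaleE, paddE).
apply/clsP; exact: pc_mulDr.
Qed.
Lemma pscaleDl v : {morph pscale^~ v : a b / a + b}.
Proof.
move=> a b; have [x ->] := cls_surj v.
rewrite -[RHS]/(padd _ _) !pscaleE paddE; apply/clsP.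
exact: pc_trans (pc_mul (pc_constD _ _) (pc_refl _)) (pc_mulDl _ _ _).
Qed.

HB.instance Definition _ := GRing.Zmodule_isLmodule.Build R presalg
  pscaleA pscale1 pscaleDr pscaleDl.

Lemma cls0 : cls 0%X = 0. Proof. by []. Qed.
Lemma cls1 : cls 1%X = 1. Proof. by []. Qed.
Lemma clsD x y : cls (x + y)%X = cls x + cls y.
Proof. by rewrite -paddE. Qed.
Lemma clsM x y : cls (x * y)%X = cls x * cls y.
Proof. by rewrite -pmulE. Qed.
Lemma clsZ a x : a *: cls x = cls (Const a * x)%X.
Proof. exact: pscaleE. Qed.
Lemma cls_rel x y : gr x y -> cls x = cls y.
Proof. by move=> h; apply/clsP/pc_rel. Qed.

Lemma presalg_scaleAl (a : R) (u v : presalg) : a *: (u * v) = (a *: u) * v.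
Proof.
have [x ->] := cls_surj u; have [y ->] := cls_surj v.
by rewrite -clsM !clsZ -clsM; apply/clsP; exact: pc_mulA.
Qed.
Lemma presalg_scaleAr (a : R) (u v : presalg) : a *: (u * v) = u * (a *: v).
Proof.
have [x ->] := cls_surj u; have [y ->] := cls_surj v.
rewrite -clsM !clsZ -clsM; apply/clsP.
apply: pc_trans (pc_mulA _ _ _) _.
exact: pc_trans (pc_mul (pc_constC _ _) (pc_refl _)) (pc_sym (pc_mulA _ _ _)).
Qed.

Section Eval.
Variables (S : pzRingType) (f : {rmorphism R -> S}) (g : X -> S).

Fixpoint eval (x : expr R X) : S :=
  match x with
  | Const a => f a
  | Gen i => g i
  | Add x y => eval x + eval y
  | Mul x y => eval x * eval y
  end.

Lemma eval_pcong : (forall a s, f a * s = s * f a) ->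
  (forall x y, gr x y -> eval x = eval y) ->
  forall x y, pcong x y -> eval x = eval y.
Proof.
move=> fC grel x y; elim => {x y} /=.
- exact: grel.
- by [].
- by [].
- by move=> x y z _ -> _ ->.
- by move=> x x' y y' _ -> _ ->.
- by move=> x x' y y' _ -> _ ->.
- by move=> *; rewrite addrA.
- by move=> *; rewrite addrC.
- by move=> *; rewrite rmorph0 add0r.
- by move=> *; rewrite rmorphN1 mulN1r addNr rmorph0.
- by move=> *; rewrite mulrA.
- by move=> *; rewrite rmorph1 mul1r.
- by move=> *; rewrite rmorph1 mulr1.
- by move=> *; rewrite mulrDl.
- by move=> *; rewrite mulrDr.
- by move=> *; rewrite rmorphD.
- by move=> *; rewrite rmorphM.
- by move=> *; rewrite fC.
Qed.

End Eval.

End Presentation.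

(** * Bases of modules *)

Section Basis.
Variables (A : pzRingType) (V : lmodType A) (I : choiceType) (b : I -> V).

Definition spans : Prop :=
  forall v : V, exists (s : seq I) (c : I -> A), v = \sum_(i <- s) c i *: b i.

Definition lin_indep : Prop :=
  forall (s : seq I) (c : I -> A), uniq s ->
    \sum_(i <- s) c i *: b i = 0 -> forall i, i \in s -> c i = 0.

Definition is_basis : Prop := spans /\ lin_indep.

End Basis.

(** * Reflections and hyperplanes *)

Section Reflections.
Variables (K : fieldType) (n : nat).
Implicit Types (g : 'M[K]_n).

Definition ker1 g : {vspace 'cV[K]_n} := lker (linfun (mulmx (g - 1%:M))).

Lemma ker1P g v : (v \in ker1 g) = (g *m v == v).
Proof. by rewrite memv_ker lfunE /= mulmxBl mul1mx subr_eq0. Qed.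

Definition hact g (H : {vspace 'cV[K]_n}) : {vspace 'cV[K]_n} := (linfun (mulmx g) @: H)%VS.

Definition is_reflection g : Prop :=
  g \in unitmx /\ (\dim (ker1 g)).+1 = n.

Variable W : set 'M[K]_n.

Definition reflections : set W := [set r : W | is_reflection (val r)].

Definition hyperplanes : set {vspace 'cV[K]_n} :=
  [set H | exists2 r : W, reflections r & H = ker1 (val r)].

Definition conjugate (s s' : W) : Prop :=
  exists w : W, val w *m val s *m invmx (val w) = val s'.

Definition transverse (H1 H2 : hyperplanes) : Prop :=
  H1 <> H2 /\ forall H : hyperplanes,
    (val H1 :&: val H2 <= val H)%VS -> H = H1 \/ H = H2.

Definition ptstab (H : hyperplanes) : set W :=
  [set w : W | (val H <= ker1 (val w))%VS].

Definition left_transversal (G : set W) (T : set W) : Prop :=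
  forall w : W, exists! t : W, T t /\
    exists2 h : W, G h & val w = val t *m val h.

(** * The coefficient ring *)

Inductive coef_gen : Type :=
| Delta
| DeltaInv
| Mu of reflections
| MuInv of reflections.

Inductive coef_rel : expr int coef_gen -> expr int coef_gen -> Prop :=
| coef_comm x y : coef_rel (Gen x * Gen y)%X (Gen y * Gen x)%X
| coef_delta : coef_rel (Gen Delta * Gen DeltaInv)%X 1%X
| coef_mu s : coef_rel (Gen (Mu s) * Gen (MuInv s))%X 1%X
| coef_conj s s' of conjugate (val s) (val s') :
    coef_rel (Gen (Mu s)) (Gen (Mu s')).

Definition coef : Type := presalg coef_rel.

HB.instance Definition _ := GRing.PzRing.on coef.

Lemma coef_mulC : commutative (@GRing.mul coef).
Proof.
have comC a (u : coef) : cls coef_rel (Const a) * u = u * cls coef_rel (Const a).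
  have [x ->] := cls_surj u.
  by rewrite -!clsM; apply/clsP; exact: pc_constC.
have comG z (u : coef) : cls coef_rel (Gen z) * u = u * cls coef_rel (Gen z).
  have [x ->] := cls_surj u.
  elim: x => [a|y|x IHx y IHy|x IHx y IHy].
  - by rewrite comC.
  - by rewrite -!clsM; apply: cls_rel; constructor.
  - by rewrite clsD mulrDr IHx IHy mulrDl.
  - by rewrite clsM mulrA IHx -mulrA IHy mulrA.
move=> u v; have [x ->] := cls_surj u.
elim: x => [a|y|x IHx y IHy|x IHx y IHy].
- by rewrite comC.
- by rewrite comG.
- by rewrite clsD mulrDl IHx IHy mulrDr.
- by rewrite clsM -mulrA IHy mulrA IHx mulrA.
Qed.

HB.instance Definition _ := GRing.PzRing_hasCommutativeMul.Build coef coef_mulC.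

Lemma coef_oner_neq0 : (1 : coef) != 0.
Proof.
apply/eqP => /(clsP coef_rel 1%X 0%X) h.
have /= := eval_pcong (f := idfun) (g := fun=> 1 : int) _ _ h.
move=> e; suff: (1 : int) = 0 by [].
apply: e; first by move=> a s; rewrite mulrC.
by move=> x y; case => //= *; rewrite ?mulr1.
Qed.

HB.instance Definition _ := GRing.PzSemiRing_isNonZero.Build coef coef_oner_neq0.

Definition delta : coef := cls coef_rel (Gen Delta).
Definition mu (s : reflections) : coef := cls coef_rel (Gen (Mu s)).

(** * The Brauer-Chen algebra *)

Inductive br_gen : Type :=
| GrpGen of W
| HypGen of hyperplanes.

Local Notation "[w x ]" := (Gen (GrpGen x)) (format "[w  x ]").
Local Notation "[e H ]" := (Gen (HypGen H)) (format "[e  H ]").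

(** The relations are meant for [W] a finite subgroup of GL_n: then inverses,
    products and images of hyperplanes exist in [W] and [hyperplanes], and the
    sequence [l] enumerating the reflections which map [H2] to [H1] exists. *)
Inductive br_rel : expr coef br_gen -> expr coef br_gen -> Prop :=
| br_W1 w of val w = 1%:M :
    br_rel [w w] 1%X
| br_WM w1 w2 w3 of val w3 = val w1 *m val w2 :
    br_rel ([w w1] * [w w2])%X [w w3]
| br_B1 (H : hyperplanes) :
    br_rel ([e H] * [e H])%X (Const delta * [e H])%X
| br_B2 w w' H H' of val w' = invmx (val w) & val H' = hact (val w) (val H) :
    br_rel ([w w] * [e H] * [w w'])%X [e H']
| br_B3 w H of (val H <= ker1 (val w))%VS :
    br_rel ([w w] * [e H])%X [e H]
| br_B4 H1 H2 of transverse H1 H2 :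
    br_rel ([e H1] * [e H2])%X ([e H2] * [e H1])%X
| br_B5 H1 H2 (l : seq reflections) of
    H1 <> H2 & ~ transverse H1 H2 & uniq l
    & (forall s, s \in l <-> hact (val (val s)) (val H2) = val H1) :
    br_rel ([e H1] * [e H2])%X
      (\big[@Add _ _/0%X]_(s <- l) (Const (mu s) * [w val s] * [e H2])%X).

Definition Br : Type := presalg br_rel.

HB.instance Definition _ := GRing.Lmodule.on Br.
HB.instance Definition _ := GRing.PzRing.on Br.

Lemma Br_oner_neq0 : (1 : Br) != 0.
Proof.
apply/eqP => /(clsP br_rel 1%X 0%X) h.
pose g x : coef := if x is GrpGen _ then 1 else 0.
have e : (1 : coef) = 0.
  apply: (eval_pcong (f := idfun) (g := g) _ _ h).
    by move=> a s; rewrite mulrC.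
  move=> x y; case => //= *; rewrite ?mulr0 ?mul0r ?mulr1 //.
  by elim/big_rec: _ => //= s z _ <-; rewrite mulr0 addr0.
by move/eqP: coef_oner_neq0; rewrite e.
Qed.

HB.instance Definition _ := GRing.PzSemiRing_isNonZero.Build Br Br_oner_neq0.
HB.instance Definition _ :=
  GRing.Lmodule_isLalgebra.Build coef Br (@presalg_scaleAl _ _ br_rel).
HB.instance Definition _ :=
  GRing.Lalgebra_isAlgebra.Build coef Br (@presalg_scaleAr _ _ br_rel).

Definition br_w (w : W) : Br := cls br_rel [w w].
Definition br_e (H : hyperplanes) : Br := cls br_rel [e H].

(** All the [w e_H] lie in the kernel of the morphism from [Br] to the group
    algebra of [W] which is the identity on [W] and kills every [e_H], so they
    span a proper ideal; a basis of [Br] also has to contain the elements of [W]. *)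
Definition br_family (T : hyperplanes -> set W)
    (i : W + {H : hyperplanes & T H}) : Br :=
  match i with
  | inl w => br_w w
  | inr p => br_w (val (tagged p)) * br_e (tag p)
  end.

End Reflections.

(** * The group G_26 *)

Section G26.
Variable R : realType.
Local Notation C := R[i].

Definition zeta : C := (cos (2 * pi / 3) +i* sin (2 * pi / 3))%C.

Definition form_ker (a : 'rV[C]_3) : {vspace 'cV[C]_3} := lker (linfun (mulmx a)).

Definition has_order (g : 'M[C]_3) (m : nat) : Prop :=
  [/\ (0 < m)%N, g ^+ m = 1 & forall k, (0 < k < m)%N -> g ^+ k <> 1].

Definition unitary_reflection (m : nat) (H : {vspace 'cV[C]_3}) (g : 'M[C]_3) :=
  [/\ g \is unitarymx, is_reflection g, ker1 g = H & has_order g m].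

(** [G26_mirror m H]: the reflections of order [m] with hyperplane [H] are
    among the generators of G_26. *)
Inductive G26_mirror : nat -> {vspace 'cV[C]_3} -> Prop :=
| mirror_coord (i : 'I_3) :
    G26_mirror 3 (form_ker (delta_mx 0 i))
| mirror_sum (k l : 'I_3) :
    G26_mirror 3 (form_ker (\row_j [:: 1; zeta ^+ k; zeta ^+ l]`_j))
| mirror_diff (i j k : 'I_3) of i != j :
    G26_mirror 2 (form_ker (delta_mx 0 i - zeta ^+ k *: delta_mx 0 j)).

Inductive G26 : set 'M[C]_3 :=
| G26_gen m H g of G26_mirror m H & unitary_reflection m H g : G26 g
| G26_1 : G26 1%:M
| G26_M g h of G26 g & G26 h : G26 (g *m h)
| G26_V g of G26 g : G26 (invmx g).

End G26.

Arguments G26 R _ : clear implicits.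

(* Main.v *)
Require Import Defs.
From Stdlib Require BinInt.
From mathcomp Require Import all_boot all_order all_algebra.
From mathcomp Require Import boolp classical_sets reals trigo complex.
From mathcomp Require Import ssrZ ring lra.

(** Linear independence holds for every finite reflection group: the rule
    [e_H1 e_H2 = sum of mu_s s e_H2 over the reflections s with s H2 = H1], for
    all [H1 <> H2], makes the free module on [W] and the [w e_H] an algebra
    which is a quotient of [Br], the sum being empty for transverse mirrors.

    Spanning amounts to [e_H1 e_H2 = 0] for transverse [H1], [H2]. In [G_26] such
    mirrors have different orders, and form a single orbit, so fix [x = e_i e_j].
    If [k] has the order of [i] and is transverse neither to [i] nor to [j] then
    [e_k e_j = 0], so [0 = e_k x] is a combination of the [s x] with [s i = k].
    Applying [e_m] with [m = s j] turns it into a combination of the [c x] with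
    [c] in the centre of [G_26], which is cyclic of order 6; the same holds with
    [i] and [j] exchanged. Five of these relations generate the unit ideal of the
    group algebra of the centre, hence [x = 0].

    The 33 reflections are found from the action on 54 short vectors of an
    Eisenstein lattice: a unitary reflection is determined by the image of a
    vector which it moves. *)

Set Implicit Arguments.
Unset Strict Implicit.
Unset Printing Implicit Defensive.
Import GRing.Theory Num.Theory Order.TTheory.
Local Open Scope ring_scope.

(** * Linear independence *)

(** B4 only makes [e_i] and [e_j] commute, so their vanishing has to be forced. Its source is that
    mirrors of different orders lie in different orbits: for such a pair that is not transverse, the
    sum in B5 is empty. Hence [e_k e_j = 0] for [k] of the order of [i], and
    [e_k x = e_k e_j e_i = 0] since [x = e_j e_i]. The centre appears because the stabilizer of a
    transverse pair is generated by the centre and by the reflections in the two mirrors, which fix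
    [x]; the words in each chosen relation all carry the pair to one and the same pair, so after
    cancelling a common reflection they act on [x] through the centre. The coefficients are products
    of [u], [v] (reflections of order 3 with eigenvalue [zeta], [zeta^2]), [t] (order 2) and [d]
    ([delta]). Only their invertibility matters: with [n] the central element [-1], the relations
    yield on [x] successively [u^2 = v^2], [u n = v], [4 = 0], [2 = 0], [1 = 0]. *)

Section Operators.
Variables (R : comPzRingType) (X Y : Type) (gr : expr R X -> expr R X -> Prop).
Variable G : X -> (Y -> R) -> (Y -> R).

Fixpoint act (x : expr R X) (f : Y -> R) : Y -> R :=
  match x with
  | Const a => fun y => a * f y
  | Gen i => G i f
  | Add x1 x2 => fun y => act x1 f y + act x2 f y
  | Mul x1 x2 => act x1 (act x2 f)
  end.

Definition linear_op (L : (Y -> R) -> Y -> R) :=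
  forall a f g, L (fun y => a * f y + g y) = (fun y => a * L f y + L g y).

Hypothesis Glin : forall i, linear_op (G i).

Lemma act_linear x : linear_op (act x).
Proof.
elim: x => [b|i|x IHx y IHy|x IHx y IHy] a f g //=.
- by apply/funext => y; rewrite mulrDr mulrCA.
- exact: Glin.
- by rewrite IHx IHy; apply/funext => z; rewrite mulrDr addrACA.
- by rewrite IHy IHx.
Qed.

Lemma actD x f g : act x (fun y => f y + g y) = (fun y => act x f y + act x g y).
Proof.
have := act_linear x 1 f g.
by under eq_fun do rewrite mul1r; under [RHS]eq_fun do rewrite mul1r.
Qed.

Lemma act0 x : act x (fun=> 0) = (fun=> 0).
Proof.
have := act_linear x (-1) (fun=> 0) (fun=> 0).
under eq_fun do rewrite mulr0 addr0; under [RHS]eq_fun do rewrite mulN1r addNr.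
by [].
Qed.

Lemma actZ x a f : act x (fun y => a * f y) = (fun y => a * act x f y).
Proof.
have := act_linear x a f (fun=> 0); rewrite act0.
by under eq_fun do rewrite addr0; under [RHS]eq_fun do rewrite addr0.
Qed.

Hypothesis Ggr : forall x y, gr x y -> act x = act y.

(** Linearity of the generators enters for [pc_mulDr] and [pc_constC]; the other rules hold for
    arbitrary operators. *)
Lemma act_pcong x y : pcong gr x y -> act x = act y.
Proof.
elim => {x y} /=.
- exact: Ggr.
- by [].
- by [].
- by move=> x y z _ -> _ ->.
- by move=> x x' y y' _ -> _ ->.
- by move=> x x' y y' _ -> _ ->.
- by move=> x y z; apply/funext => f; apply/funext => t; rewrite addrA.
- by move=> x y; apply/funext => f; apply/funext => t; rewrite addrC.
- by move=> x; apply/funext => f; apply/funext => t; rewrite mul0r add0r.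
- by move=> x; apply/funext => f; apply/funext => t; rewrite mulN1r addNr mul0r.
- by [].
- by move=> x; apply/funext => f; apply/funext => t; rewrite mul1r.
- by move=> x; apply/funext => f; under eq_fun do rewrite mul1r.
- by [].
- by move=> x y z; apply/funext => f; rewrite actD.
- by move=> a b; apply/funext => f; apply/funext => t; rewrite mulrDl.
- by move=> a b; apply/funext => f; apply/funext => t; rewrite mulrA.
- by move=> a x; apply/funext => f; rewrite actZ.
Qed.

Definition act_cls (u : presalg gr) := act (repr u).

Lemma act_clsE x : act_cls (cls gr x) = act x.
Proof. exact/act_pcong/repr_cls. Qed.

Lemma act_clsM u v f : act_cls (u * v) f = act_cls u (act_cls v f).
Proof.
have [x ->] := cls_surj u; have [y ->] := cls_surj v.
by rewrite -clsM !act_clsE.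
Qed.

Lemma act_cls_sum (I : Type) (s : seq I) (c : I -> R) (b : I -> presalg gr) f y :
  act_cls (\sum_(i <- s) c i *: b i) f y = \sum_(i <- s) c i * act_cls (b i) f y.
Proof.
elim: s => [|i s IHs]; first by rewrite !big_nil -cls0 act_clsE /= mul0r.
rewrite !big_cons -IHs; move: (\sum_(_ <- s) _) (b i) => u v.
have [x ->] := cls_surj u; have [z ->] := cls_surj v.
by rewrite clsZ -clsD !act_clsE.
Qed.

End Operators.

(** * The left regular action of the candidate algebra, for a finite group [W] *)

Section Independence.
Variables (K : fieldType) (n : nat) (W : set 'M[K]_n).
Hypothesis WU : forall g, W g -> g \in unitmx.
Hypothesis W1 : W 1%:M.
Hypothesis WM : forall g h, W g -> W h -> W (g *m h).
Hypothesis WV : forall g, W g -> W (invmx g).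
Variable eW : seq 'M[K]_n.
Hypothesis eWu : uniq eW.
Hypothesis eWP : forall g, g \in eW <-> W g.
Local Notation refls := (@reflections K n W).
Variable lR : seq refls.
Hypothesis lRu : uniq lR.
Hypothesis lRP : forall s, s \in lR.

Implicit Types (w : W) (s : refls) (g : 'M[K]_n) (H U : {vspace 'cV[K]_n}) (q : 'End('cV[K]_n)).

Lemma valW (w : W) : W (val w).
Proof. exact: set_valP. Qed.

Definition mop g : 'End('cV[K]_n) := linfun (mulmx g).

Lemma mopM g h : mop (g *m h) = (mop g \o mop h)%VF.
Proof. by apply/lfunP => v; rewrite comp_lfunE !lfunE /= mulmxA. Qed.

Lemma mop1 : mop 1%:M = \1%VF.
Proof. by apply/lfunP => v; rewrite id_lfunE lfunE /= mul1mx. Qed.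

Lemma hactM g h H : hact (g *m h) H = hact g (hact h H).
Proof. by rewrite /hact -!/(mop _) mopM limg_comp. Qed.

Lemma hact1 H : hact 1%:M H = H.
Proof. by rewrite /hact -/(mop _) mop1 lim1g. Qed.

Lemma hactK g H : g \in unitmx -> hact (invmx g) (hact g H) = H.
Proof. by move=> u; rewrite -hactM mulVmx // hact1. Qed.

Lemma hactKV g H : g \in unitmx -> hact g (hact (invmx g) H) = H.
Proof. by move=> u; rewrite -hactM mulmxV // hact1. Qed.

Lemma dim_hact g H : g \in unitmx -> \dim (hact g H) = \dim H.
Proof.
move=> u; apply/limg_dim_eq/eqP; rewrite -subv0; apply/subvP => v.
rewrite memv_cap memv_ker lfunE /= => /andP[_ /eqP e].
by rewrite memv0 -[v]mul1mx -(mulVmx u) -mulmxA e mulmx0.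
Qed.

Lemma invmx_mul g h : g \in unitmx -> h \in unitmx ->
  invmx (g *m h) = invmx h *m invmx g.
Proof.
move=> ug uh; rewrite -[RHS](mulmxK (_ : g *m h \in unitmx)) ?unitmx_mul ?ug //.
by rewrite -[_ *m (g *m h)]mulmxA (mulKmx ug) mulVmx // mul1mx.
Qed.

Lemma ker1_conj h g : h \in unitmx ->
  ker1 (h *m g *m invmx h) = hact h (ker1 g).
Proof.
move=> u; apply/vspaceP => v; rewrite ker1P.
rewrite -[v in RHS](mulKVmx u).
have -> x : (h *m x \in hact h (ker1 g)) = (x \in ker1 g).
  apply/idP/idP => [/memv_imgP[y yk]|xk].
    by rewrite lfunE /= => /(can_inj (mulKmx u)) ->.
  by apply/memv_imgP; exists x => //; rewrite lfunE.
rewrite ker1P -!mulmxA; apply/eqP/eqP => [e|->]; last by rewrite mulKVmx.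
by rewrite -{2}e mulKmx.
Qed.

Lemma conj_refl (w : W) (s : refls) :
  {s' : refls | val (val s') = val w *m val (val s) *m invmx (val w)}.
Proof.
pose g := val w *m val (val s) *m invmx (val w).
have Wg : W g by apply: WM; [apply: WM; exact: valW|exact/WV/valW].
have rg : (refls) (SigSub (mem_set Wg)).
  have [us ds] : is_reflection (val (val s)) by exact: (set_valP s).
  have uw := WU (valW w).
  split; first by rewrite /= !unitmx_mul uw us unitmx_inv uw.
  by rewrite /= ker1_conj // dim_hact.
by exists (SigSub (mem_set rg)).
Qed.

Definition cj (w : W) (s : refls) := sval (conj_refl w s).

Lemma cjE w s : val (val (cj w s)) = val w *m val (val s) *m invmx (val w).
Proof. exact: (svalP (conj_refl w s)). Qed.

Lemma cj_inj w : injective (cj w).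
Proof.
move=> s t e; apply/val_inj/val_inj; have uw := WU (valW w).
have := cjE w s; rewrite e cjE => /(congr1 (mulmx^~ (val w))).
by rewrite !mulmxKV // => /(can_inj (mulKmx uw)).
Qed.

Lemma mu_cj w s : mu (cj w s) = mu s.
Proof. by apply/esym/cls_rel/coef_conj; exists w; rewrite cjE. Qed.

Lemma perm_cj w : perm_eq (map (cj w) lR) lR.
Proof.
have mu_ : uniq (map (cj w) lR) by rewrite map_inj_uniq //; exact: cj_inj.
apply: uniq_perm => // s; apply/idP/idP => // _.
by have [//|_ e] := uniq_min_size mu_ (fun x _ => lRP x); rewrite ?size_map // e lRP.
Qed.

Lemma perm_mulW (w : W) : perm_eq (map (mulmx (val w)) eW) eW.
Proof.
have mu_ : uniq (map (mulmx (val w)) eW).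
  by rewrite map_inj_uniq //; exact: (can_inj (mulKmx (WU (valW w)))).
have sub : {subset map (mulmx (val w)) eW <= eW}.
  by move=> _ /mapP[g /eWP gW ->]; apply/eWP/WM => //; exact: valW.
apply: uniq_perm => //.
by have [//|//] := uniq_min_size mu_ sub; rewrite ?size_map.
Qed.

Local Notation A := (coef W).

(** The point [inl g] stands for the basis element [g] of [Br], and
    [inr (H, q)], with [q] the composite of [w] and the projection onto [H],
    for [w e_H]: this [q] determines the coset [w W_H], and its image is [wH].
    Functions on these points are the dual of the left regular representation
    of the algebra having this basis. *)
Definition points : Type := ('M[K]_n + {vspace 'cV[K]_n} * 'End('cV[K]_n))%type.

Definition shift g (x : points) : points :=
  match x with
  | inl h => inl (g *m h)
  | inr (H, q) => inr (H, (mop g \o q)%VF)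
  end.

(** The coordinate of [e_H f] at [w e_U], which vanishes unless [wU = H]. The three terms come from
    [e_H w e_U = delta w e_U], from [e_H w' e_U] with [s w' = w] and [w'U] different from [H], and
    from [e_H g = g e_U] with [gU = H]. *)
Definition eop (H : {vspace 'cV[K]_n}) (f : points -> A) (x : points) : A :=
  match x with
  | inl _ => 0
  | inr (U, q) => if limg q != H then 0 else
      delta W * f (inr (U, q))
      + \sum_(s <- lR | hact (val (val s)) H != H)
          mu s * f (shift (invmx (val (val s))) (inr (U, q)))
      + \sum_(g <- eW | (mop g \o projv U)%VF == q) f (inl g)
  end.

Definition gop (i : br_gen W) (f : points -> A) : points -> A :=
  match i with
  | GrpGen w => fun x => f (shift (invmx (val w)) x)
  | HypGen H => eop (val H) f
  end.

Lemma shiftM g h x : shift (g *m h) x = shift g (shift h x).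
Proof. by case: x => [k|[H q]] /=; rewrite ?mulmxA // mopM comp_lfunA. Qed.

Lemma shift1 x : shift 1%:M x = x.
Proof. by case: x => [k|[H q]] /=; rewrite ?mul1mx // mop1 comp_lfun1l. Qed.

Lemma limg_mop g q : limg (mop g \o q)%VF = hact g (limg q).
Proof. by rewrite limg_comp. Qed.

Lemma gop_linear i : linear_op (gop i).
Proof.
case: i => [w|H] a f g; apply/funext; case=> [h|[U q]] //=.
  by rewrite mulr0 addr0.
case: ifP => _; first by rewrite mulr0 addr0.
under [X in _ + X + _]eq_bigr do rewrite mulrDr mulrCA.
rewrite !big_split /= -!mulr_sumr !mulrDr [delta W * (a * _)]mulrCA.
by rewrite [X in X + _ = _]addrACA [LHS]addrACA.
Qed.

(** This is B2: conjugation by [w] permutes the reflections without changing [mu], and translation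
    by [w] permutes [W], so both sums are reindexed. *)
Lemma eop_shift (w : W) H f :
  (fun x => eop H (fun y => f (shift (val w) y)) (shift (invmx (val w)) x)) =
  eop (hact (val w) H) f.
Proof.
have uw := WU (valW w).
apply/funext; case=> [h|[U q]] //=.
have -> : (limg (mop (invmx (val w)) \o q)%VF != H) = (limg q != hact (val w) H).
  rewrite limg_mop; congr negb; apply/eqP/eqP => [<-|->]; first by rewrite hactKV.
  by rewrite hactK.
case: ifP => // _; congr (_ + _ + _).
- by rewrite comp_lfunA -mopM mulmxV // mop1 comp_lfun1l.
- rewrite -[RHS](perm_big _ (perm_cj w)) big_map /=.
  apply: eq_big => s; rewrite ?mu_cj cjE; last first.
    move=> _; congr (_ * f (inr (_, _))); rewrite !comp_lfunA -!mopM.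
    have us : val (val s) \in unitmx by exact: WU (valW _).
    by rewrite !invmx_mul ?unitmx_mul ?uw ?us ?unitmx_inv // invmxK !mulmxA.
  congr negb; rewrite -hactM mulmxKV // hactM.
  apply/eqP/eqP => [->//|/(congr1 (hact (invmx (val w))))].
  by rewrite !hactK.
- rewrite -[RHS](perm_big _ (perm_mulW w)) big_map /=.
  apply: eq_bigl => g; rewrite mopM -comp_lfunA.
  apply/eqP/eqP => [->|<-].
    by rewrite comp_lfunA -mopM mulmxV // mop1 comp_lfun1l.
  by rewrite [RHS]comp_lfunA -mopM mulVmx // mop1 comp_lfun1l.
Qed.

Lemma eop0 H f U q : limg q != H -> eop H f (inr (U, q)) = 0.
Proof. by move=> /= ->. Qed.

Lemma eop_img H f U q : limg q = H -> eop H f (inr (U, q)) =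
  delta W * f (inr (U, q))
  + \sum_(s <- lR | hact (val (val s)) H != H)
      mu s * f (shift (invmx (val (val s))) (inr (U, q)))
  + \sum_(g <- eW | (mop g \o projv U)%VF == q) f (inl g).
Proof. by move=> e; rewrite /= e eqxx. Qed.

Lemma unit_refl s : val (val s) \in unitmx.
Proof. exact: WU (valW _). Qed.

Lemma eop_eop H f : eop H (eop H f) = fun x => delta W * eop H f x.
Proof.
apply/funext; case=> [h|[U q]]; first by rewrite mulr0.
have [e|h] := eqVneq (limg q) H; last by rewrite !eop0 // mulr0.
rewrite eop_img // [X in _ + X]big1 // addr0 [X in _ + X]big1_seq ?addr0 // => s.
move=> /andP[sH _]; rewrite eop0 ?mulr0 // limg_mop e.
by apply: contra sH => /eqP h; rewrite -{1}h hactKV // unit_refl.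
Qed.

(** [eop H2 f] lives on the points of image [H2]; at a point of image [H1] only the reflections with
    [s H2 = H1] contribute. *)
Lemma eop_eop_neq H1 H2 f (l : seq refls) : H1 != H2 -> uniq l ->
  (forall s, s \in l <-> hact (val (val s)) H2 = H1) ->
  eop H1 (eop H2 f) =
  fun x => \sum_(s <- l) mu s * eop H2 f (shift (invmx (val (val s))) x).
Proof.
move=> H12 lu lP; apply/funext; case=> [h|[U q]].
  by rewrite big1 // => s _; rewrite mulr0.
have eqH s : (hact (invmx (val (val s))) H1 == H2) = (s \in l).
  apply/eqP/idP => [e|/lP <-]; last by rewrite hactK ?unit_refl.
  by apply/lP; rewrite -e hactKV ?unit_refl.
have [e|h] := eqVneq (limg q) H1; last first.
  rewrite eop0 // big1_seq // => s /andP[_ /lP sl].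
  rewrite eop0 ?mulr0 // limg_mop.
  by apply: contra h => /eqP h; rewrite -sl -h hactKV ?unit_refl.
rewrite eop_img // eop0 ?e // mulr0 add0r [X in _ + X]big1 // addr0.
rewrite (bigID (fun s => s \in l)) /= [X in _ + X]big1 ?addr0; last first.
  by move=> s /andP[_ sl]; rewrite -/(eop _ _ (inr (_, _))) eop0 ?mulr0 // limg_mop e eqH.
rewrite -big_filter; apply: perm_big; apply: uniq_perm => //.
  exact: filter_uniq.
move=> s; rewrite mem_filter lRP andbT; case sl: (s \in l); rewrite ?andbF // andbT.
apply: contra H12 => /eqP h; move: sl; rewrite -eqH => /eqP <-.
by rewrite -{2}h hactK ?unit_refl.
Qed.

(** If [q] has image [H], which [w] fixes pointwise, then composing [q] with the inverse of [w]
    gives back [q]. *)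
Lemma eop_fix w H f : (H <= ker1 (val w))%VS ->
  (fun x => eop H f (shift (invmx (val w)) x)) = eop H f.
Proof.
move=> Hw; have uw := WU (valW w).
have fixq q : limg q = H -> (mop (invmx (val w)) \o q)%VF = q.
  move=> qH; apply/lfunP => v; rewrite comp_lfunE lfunE /=.
  have : q v \in H by rewrite -qH memv_img // memvf.
  move=> /(subvP Hw); rewrite ker1P => /eqP e.
  by rewrite -{1}e mulKmx.
apply/funext; case=> [h|[U q]] //.
have [e|h] := eqVneq (limg q) H; first by rewrite /shift fixq.
rewrite [RHS]eop0 // eop0 // limg_mop; apply: contra h => /eqP h.
apply/eqP; rewrite -[limg q](hactKV _ uw) h.
apply/vspaceP => v; apply/memv_imgP/idP => [[u uH ->]|vH].
  by move/(subvP Hw): (uH); rewrite ker1P lfunE /= => /eqP ->.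
by exists v => //; move/(subvP Hw): vH; rewrite ker1P lfunE /= => /eqP ->.
Qed.

Lemma hact_ker1 g : hact g (ker1 g) = ker1 g.
Proof.
have fixg x : x \in ker1 g -> g *m x = x by rewrite ker1P => /eqP.
apply/vspaceP => v; apply/memv_imgP/idP => [[u uH ->]|vH].
  by rewrite lfunE /= fixg.
by exists v => //; rewrite lfunE /= fixg.
Qed.

(** If [s] moves some [y] in [H2] to a point of [H2], then the line of
    displacements of [s] lies in [H2], hence [s] stabilizes [H2]. *)
Lemma refl_capv s H1 H2 : hact (val (val s)) H2 = H1 -> H1 <> H2 ->
  (H1 :&: H2 <= ker1 (val (val s)))%VS.
Proof.
set g := val (val s) => e H12; apply/subvP => v; rewrite memv_cap => /andP[].
rewrite -{1}e => /memv_imgP[y yH2 ->]; rewrite lfunE /= => gyH2.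
rewrite ker1P; have [h|gy] := eqVneq (g *m y) y; first by rewrite !h.
case: H12; apply/eqP; rewrite eqEdim -{2}e dim_hact ?unit_refl // leqnn andbT.
pose f : 'End('cV[K]_n) := linfun (mulmx (g - 1%:M)).
have fE x : f x = g *m x - x by rewrite lfunE /= mulmxBl mul1mx.
have dim1 : \dim (limg f) = 1.
  have [_ d] : is_reflection g by exact: (set_valP s).
  have := limg_ker_dim f fullv; rewrite capfv -/(ker1 g) dimvf /dim /= muln1 => h.
  by apply/eqP; rewrite -(eqn_add2l (\dim (ker1 g))) h addn1 d.
have im : (limg f <= H2)%VS.
  suff -> : limg f = <[g *m y - y]>%VS by rewrite -memvE memvB.
  apply/eqP; rewrite eq_sym eqEdim dim1 dim_vline subr_eq0 gy andbT -memvE -fE.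
  by rewrite memv_img ?memvf.
rewrite -e; apply/subvP => _ /memv_imgP[x xH2 ->]; rewrite lfunE /=.
rewrite -[g *m x](subrK x) memvD // -fE (subvP im) //.
by rewrite memv_img ?memvf.
Qed.

(** By [refl_capv] the mirror of such an [s] would contain the intersection, hence be [H1] or [H2];
    but [s] stabilizes its own mirror. *)
Lemma transverse_refl (H1 H2 : hyperplanes W) s : transverse H1 H2 ->
  hact (val (val s)) (val H2) <> val H1.
Proof.
move=> [H12 tr] e; pose g := val (val s).
have neq : val H1 <> val H2 by move/val_inj.
have hs : hyperplanes W (ker1 g) by exists (val s) => //; exact: set_valP s.
have [h|h] := tr (SigSub (mem_set hs)) (refl_capv e neq).
  have k : val H1 = ker1 g by rewrite -h.
  by apply: neq; rewrite -[RHS](hactK _ (unit_refl s)) e k -[in RHS]hact_ker1 hactK ?unit_refl.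
have k : val H2 = ker1 g by rewrite -h.
by apply: neq; rewrite -e k hact_ker1.
Qed.

Lemma gop_rel x y : br_rel x y -> act gop x = act gop y.
Proof.
case=> {x y}.
- move=> w w1; apply/funext => f; apply/funext => x /=.
  by rewrite w1 invmx1 shift1 mul1r.
- move=> w1 w2 w3 e; apply/funext => f; apply/funext => x /=.
  by rewrite e invmx_mul ?shiftM //; exact/WU/valW.
- by move=> H; apply/funext => f; exact: eop_eop.
- move=> w w' H H' ew eH; apply/funext => f /=.
  by rewrite eH -eop_shift ew invmxK.
- by move=> w H Hw; apply/funext => f; exact: eop_fix.
- move=> H1 H2 tr; apply/funext => f /=.
  have neq : val H1 != val H2 by apply/eqP => /val_inj; case: tr.
  have tr' : transverse H2 H1.
    by case: tr => h k; split=> [e|H]; [exact: h|rewrite capvC => /k[]; [right|left]].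
  (* Both products are empty sums, so B4 holds because the two sides vanish. *)
  rewrite (@eop_eop_neq _ _ _ [::]) //; last first.
    by move=> s; split=> // /(transverse_refl tr).
  rewrite (@eop_eop_neq _ _ _ [::]) 1?eq_sym //; last first.
    by move=> s; split=> // /(transverse_refl tr').
  by apply/funext => x; rewrite !big_nil.
- move=> H1 H2 l H12 _ lu lP; apply/funext => f /=.
  rewrite (@eop_eop_neq _ _ _ l) //; last by apply/eqP => /val_inj.
  apply/funext => x; elim: (l) => [|s l' IH]; first by rewrite !big_nil /= mul0r.
  by rewrite !big_cons /= IH.
Qed.

Variable T : hyperplanes W -> set W.
Hypothesis hT : forall H : hyperplanes W, left_transversal (ptstab H) (T H).

Definition point (i : W + {H : hyperplanes W & T H}) : points :=
  match i with
  | inl w => inl (val w)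
  | inr p => inr (val (tag p),
      (mop (val (val (tagged p))) \o projv (val (tag p)))%VF)
  end.

(** The unit of the algebra: an element applied to it yields its own coordinates, which [act_family]
    computes for the family. *)
Definition unit_fun (x : points) : A :=
  if x is inl g then (g == 1%:M)%:R else 0.

(** Agreement on [H] puts the quotient of [t] and [t'] in [W_H], and a transversal meets each coset
    once. *)
Lemma mop_projv_inj (H : hyperplanes W) (t t' : T H) :
  (mop (val (val t)) \o projv (val H) = mop (val (val t')) \o projv (val H))%VF ->
  t = t'.
Proof.
move=> e; apply: val_inj.
have [u [_ uu]] := hT H (val t).
rewrite -(uu (val t)); last first.
  split; first exact: set_valP.
  exists (SigSub (mem_set W1)); last by rewrite /= mulmx1.
  by apply/subvP => v _; rewrite ker1P mul1mx.
apply: uu; split; first exact: set_valP.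
have uw := WU (valW (val t')).
have Wh : W (invmx (val (val t')) *m val (val t)).
  by apply: WM; [exact/WV/valW|exact: valW].
exists (SigSub (mem_set Wh)); last by rewrite /= mulKVmx.
apply/subvP => v vH; rewrite ker1P /=.
have := congr1 (fun k => fun_of_lfun k v) e.
rewrite !comp_lfunE !lfunE /= projv_id // => ev.
by rewrite -mulmxA ev mulKmx.
Qed.

Lemma act_family i j :
  act_cls gop (br_family i) unit_fun (point j) = (i == j)%:R.
Proof.
have mopK g q : g \in unitmx -> (mop g \o (mop (invmx g) \o q))%VF = q.
  by move=> u; rewrite comp_lfunA -mopM mulmxV // mop1 comp_lfun1l.
have mopKV g q : g \in unitmx -> (mop (invmx g) \o (mop g \o q))%VF = q.
  by move=> u; rewrite comp_lfunA -mopM mulVmx // mop1 comp_lfun1l.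
case: i => [w|P].
  rewrite (act_clsE gop_linear gop_rel) /=; case: j => [w'|P'] //=.
  congr (nat_of_bool _)%:R.
  have u := WU (valW w); apply/eqP/eqP => [e|[<-]]; first congr inl.
    by apply: val_inj; rewrite /= -[RHS](mulKVmx u) e mulmx1.
  by rewrite mulVmx.
rewrite (act_clsM gop_linear gop_rel) !(act_clsE gop_linear gop_rel).
case: j => [w'|P'] //.
have u := WU (valW (val (tagged P))).
set q := (mop (val (val (tagged P'))) \o projv (val (tag P')))%VF.
set p := (mop (invmx (val (val (tagged P)))) \o q)%VF.
have -> : act gop (Gen (GrpGen (val (tagged P))))
    (act gop (Gen (HypGen (tag P))) unit_fun) (point (inr P'))
  = eop (val (tag P)) unit_fun (inr (val (tag P'), p)) by [].
have sumE : \sum_(g <- eW | (mop g \o projv (val (tag P')))%VF == p) unit_fun (inl g)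
    = (projv (val (tag P')) == p)%:R.
  rewrite big_mkcond (bigD1_seq 1%:M) //=; last exact/eWP.
  rewrite big1 ?addr0 => [|g /negPf g1]; last by case: ifP; rewrite ?g1.
  by rewrite mop1 comp_lfun1l eqxx; case: eqP.
have [e|ne] := eqVneq (limg p) (val (tag P)); last first.
  rewrite eop0 //; case: eqP => // -[eP]; case/eqP: ne.
  by rewrite /p /q -eP mopKV // limg_proj.
rewrite eop_img // sumE mulr0 add0r big1 ?add0r => [|s _]; last by rewrite mulr0.
congr (nat_of_bool _)%:R; apply/eqP/eqP => [e'|[eP]]; last first.
  by rewrite /p /q -eP mopKV.
have eH : tag P' = tag P by apply: val_inj; rewrite -e -e' limg_proj.
have {sumE e} : (mop (val (val (tagged P))) \o projv (val (tag P')))%VF = q.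
  by rewrite e' mopK.
rewrite /q; case: P P' eH {q p e' u} => H t [H' t'] /= eH; move: t'; rewrite eH => t' e.
by congr (inr (existT _ _ _)); exact: mop_projv_inj.
Qed.

Lemma br_family_free : lin_indep (br_family (T := T)).
Proof.
move=> s c us e i si.
have := act_cls_sum gop_linear gop_rel s c (br_family (T := T)) unit_fun (point i).
rewrite e -cls0 (act_clsE gop_linear gop_rel) /= mul0r (bigD1_seq i) //=.
rewrite act_family eqxx mulr1 big1 ?addr0 => [//|j ji].
by rewrite act_family (negPf ji) mulr0.
Qed.

End Independence.

(** * Generating sets *)

Section Spanning.
Variables (K : fieldType) (n : nat) (W : set 'M[K]_n).
Hypothesis WU : forall g, W g -> g \in unitmx.
Hypothesis W1 : W 1%:M.
Hypothesis WM : forall g h, W g -> W h -> W (g *m h).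
Hypothesis WV : forall g, W g -> W (invmx g).
Local Notation refls := (@reflections K n W).
Implicit Types (w : W) (s : refls) (H : hyperplanes W).

Lemma unitW w : val w \in unitmx.
Proof. exact: WU (valW w). Qed.

Definition oneW : W := SigSub (mem_set W1).
Definition mulW w1 w2 : W := SigSub (mem_set (WM (valW w1) (valW w2))).
Definition invW w : W := SigSub (mem_set (WV (valW w))).

Lemma actH_subproof w H : hyperplanes W (hact (val w) (val H)).
Proof.
have [r rr e] : hyperplanes W (val H) := set_valP H.
have uw := unitW w.
pose r' := cj WU WM WV w (SigSub (mem_set rr)).
exists (val r'); first exact: (set_valP r').
by rewrite cjE ker1_conj //= e.
Qed.

Definition actH w H : hyperplanes W := SigSub (mem_set (actH_subproof w H)).

Lemma actHKV w H : actH w (actH (invW w) H) = H.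
Proof. by apply: val_inj; rewrite /= hactKV // unitW. Qed.

Lemma br_w1 : br_w oneW = 1.
Proof. exact/cls_rel/br_W1. Qed.

Lemma br_wM w w' : br_w (mulW w w') = br_w w * br_w w'.
Proof. by rewrite /br_w -clsM; apply/esym/cls_rel/br_WM. Qed.

Lemma br_wV w : br_w (invW w) * br_w w = 1.
Proof.
by rewrite -br_wM -br_w1; congr br_w; apply: val_inj; rewrite /= mulVmx // unitW.
Qed.

Lemma br_wVr w : br_w w * br_w (invW w) = 1.
Proof.
by rewrite -br_wM -br_w1; congr br_w; apply: val_inj; rewrite /= mulmxV // unitW.
Qed.

Lemma br_ee H : br_e H * br_e H = delta W *: br_e H.
Proof. by rewrite /br_e clsZ -clsM; exact/cls_rel/br_B1. Qed.

Lemma br_we w H : br_w w * br_e H = br_e (actH w H) * br_w w.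
Proof.
have <- : br_w w * br_e H * br_w (invW w) = br_e (actH w H).
  by rewrite /br_w /br_e -(clsM _ (Gen (GrpGen w))) -clsM; exact/cls_rel/br_B2.
by rewrite -mulrA br_wV mulr1.
Qed.

Lemma br_ew w H : br_e H * br_w w = br_w w * br_e (actH (invW w) H).
Proof. by rewrite br_we actHKV. Qed.

Lemma br_fix w H : (val H <= ker1 (val w))%VS -> br_w w * br_e H = br_e H.
Proof. by move=> h; rewrite /br_w /br_e -clsM; exact/cls_rel/br_B3. Qed.

Lemma br_comm H1 H2 : transverse H1 H2 -> br_e H1 * br_e H2 = br_e H2 * br_e H1.
Proof. by move=> h; rewrite /br_e -2!clsM; exact/cls_rel/br_B4. Qed.

Lemma br_eeN H1 H2 (l : seq refls) : H1 <> H2 -> ~ transverse H1 H2 -> uniq l ->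
  (forall s, s \in l <-> hact (val (val s)) (val H2) = val H1) ->
  br_e H1 * br_e H2 = \sum_(s <- l) mu s *: (br_w (val s) * br_e H2).
Proof.
move=> h1 h2 h3 h4; rewrite /br_e -clsM (cls_rel (br_B5 h1 h2 h3 h4)).
elim: (l) => [|s l' IH]; first by rewrite !big_nil cls0.
by rewrite !big_cons clsD IH 2!clsM -mulrA -/(br_w _) -clsM clsZ.
Qed.

Variable T : hyperplanes W -> set W.
Hypothesis hT : forall H : hyperplanes W, left_transversal (ptstab H) (T H).
(** Besides B5 this asks for an expansion when the mirrors are transverse, where the list will be
    empty. *)
Hypothesis eeE : forall H1 H2, H1 <> H2 -> exists l : seq refls,
  br_e H1 * br_e H2 = \sum_(s <- l) mu s *: (br_w (val s) * br_e H2).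

Let I := (W + {H : hyperplanes W & T H})%type.

Local Notation fam := (br_family (T := T)).

(** Indices may repeat, so that sums are concatenations; coefficients are collected only in
    [br_family_spans]. *)
Definition in_span (u : Br W) := exists (l : seq (coef W * I)),
  u = \sum_(p <- l) p.1 *: fam p.2.

Lemma in_span0 : in_span 0.
Proof. by exists [::]; rewrite big_nil. Qed.

Lemma in_spanD u v : in_span u -> in_span v -> in_span (u + v).
Proof. by move=> [l ->] [k ->]; exists (l ++ k); rewrite big_cat. Qed.

Lemma in_spanZ a u : in_span u -> in_span (a *: u).
Proof.
move=> [l ->]; exists [seq (a * p.1, p.2) | p <- l].
by rewrite big_map scaler_sumr; under [RHS]eq_bigr do rewrite -scalerA.
Qed.

Lemma in_span_sum (J : Type) (l : seq J) (F : J -> Br W) :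
  (forall j, in_span (F j)) -> in_span (\sum_(j <- l) F j).
Proof.
by move=> h; elim/big_ind: _ => //; [exact: in_span0|exact: in_spanD].
Qed.

Lemma in_span_family i : in_span (fam i).
Proof. by exists [:: (1, i)]; rewrite big_seq1 scale1r. Qed.

Lemma in_span_we w H : in_span (br_w w * br_e H).
Proof.
have [t [[tT [h hh e]] _]] := hT H w.
have -> : br_w w * br_e H = br_w t * br_e H.
  have -> : w = mulW t h by exact: val_inj.
  by rewrite br_wM -mulrA br_fix.
exact: (in_span_family (inr (existT _ H (SigSub (mem_set tT))))).
Qed.

(** The span is stable under left multiplication by generators; in the main case
    [e_H' w e_H = w e_H1 e_H] with [H1] the preimage of [H'] under [w], and [eeE] applies. *)
Lemma in_spanMl x (u : Br W) : in_span u -> in_span ((cls _ x : Br W) * u).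
Proof.
elim: x u => [a|i|x IHx y IHy|x IHx y IHy] u su.
- suff -> : (cls _ (Const a) : Br W) * u = a *: u by exact: in_spanZ.
  by have [z ->] := cls_surj u; rewrite clsZ -clsM.
- have {su}[l ->] := su; rewrite mulr_sumr; apply: in_span_sum => p.
  rewrite -scalerAr; apply: in_spanZ; case: p.2 => {p} [w|[H t]]; case: i => [w'|H'] /=.
  + rewrite -/(br_w w') -br_wM; exact: (in_span_family (inl _)).
  + by rewrite -/(br_e H') br_ew; exact: in_span_we.
  + by rewrite -/(br_w w') mulrA -br_wM; exact: in_span_we.
  + rewrite -/(br_e H') mulrA br_ew -mulrA; set H1 := actH _ _.
    have [->|/eqP/eeE[k ->]] := eqVneq H1 H.
      by rewrite br_ee -scalerAr; apply: in_spanZ; exact: in_span_we.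
    rewrite mulr_sumr; apply: in_span_sum => s; rewrite -scalerAr; apply: in_spanZ.
    by rewrite mulrA -br_wM; exact: in_span_we.
- by rewrite clsD mulrDl; apply: in_spanD; [exact: IHx|exact: IHy].
- by rewrite clsM -mulrA; exact/IHx/IHy.
Qed.

Lemma br_family_spans : spans (fam).
Proof.
move=> v; have [x ->] := cls_surj v.
have [l e] : in_span ((cls _ x : Br W) * 1).
  by apply: in_spanMl; rewrite -br_w1; exact: (in_span_family (inl _)).
exists (undup (map snd l)), (fun i => \sum_(p <- l | p.2 == i) p.1).
rewrite -[LHS]mulr1 e.
under [RHS]eq_bigr do rewrite scaler_suml.
rewrite (exchange_big_dep xpredT) //= big_seq [RHS]big_seq.
apply: eq_bigr => p pl.
rewrite (big_rem p.2) /= ?mem_undup ?map_f // eqxx big_seq_cond big1 ?addr0 //.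
move=> i /andP[]; rewrite rem_filter ?undup_uniq // mem_filter => /andP[/negPf ni _].
by rewrite eq_sym ni.
Qed.

End Spanning.

(** * Unitary reflections *)

Section UnitaryReflections.
Variables (C : numClosedFieldType) (n : nat).
Implicit Types (a x : 'rV[C]_n) (g : 'M[C]_n) (w : C).

Definition adj m p (A : 'M[C]_(m, p)) : 'M[C]_(p, m) := map_mx Num.conj A^T.

Definition ip x a : C := (x *m adj a) 0 0.

Lemma adjE m p (A : 'M[C]_(m, p)) i j : adj A i j = (A j i)^*.
Proof. by rewrite !mxE. Qed.

Lemma adjM m p q (A : 'M[C]_(m, p)) (B : 'M[C]_(p, q)) :
  adj (A *m B) = adj B *m adj A.
Proof. by rewrite /adj trmx_mul map_mxM. Qed.

Lemma ipE x a : x *m adj a = (ip x a)%:M.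
Proof. exact: mx11_scalar. Qed.

Lemma ip_sum x a : ip x a = \sum_i x 0 i * (a 0 i)^*.
Proof. by rewrite /ip mxE; apply: eq_bigr => i _; rewrite adjE. Qed.

Lemma ipC x a : ip a x = (ip x a)^*.
Proof.
rewrite !ip_sum rmorph_sum; apply: eq_bigr => i _.
by rewrite rmorphM /= conjCK mulrC.
Qed.

Lemma ipDl x y a : ip (x + y) a = ip x a + ip y a.
Proof. by rewrite /ip mulmxDl mxE. Qed.

Lemma ipZl w x a : ip (w *: x) a = w * ip x a.
Proof. by rewrite /ip -scalemxAl mxE. Qed.

Lemma ipZr w x a : ip x (w *: a) = w^* * ip x a.
Proof. by rewrite ipC ipZl rmorphM /= -ipC. Qed.

Lemma ip_eq0 a : (ip a a == 0) = (a == 0).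
Proof.
apply/eqP/eqP => [|->]; last by rewrite ip_sum big1 // => i _; rewrite mxE mul0r.
rewrite ip_sum => /eqP; rewrite psumr_eq0 => [|i _]; last exact: mul_conjC_ge0.
move/allP => h; apply/rowP => i; rewrite mxE; apply/eqP.
by have := h i (mem_index_enum i); rewrite mul_conjC_eq0.
Qed.

(** Rows are acted on from the right, so that the root [a] is an eigenvector of
    eigenvalue [w]. *)
Definition rw a w : 'M[C]_n := 1%:M + ((w - 1) / ip a a) *: (adj a *m a).

Lemma mul_rw x a w : x *m rw a w = x + ((w - 1) / ip a a * ip x a) *: a.
Proof. by rewrite mulmxDr mulmx1 -scalemxAr mulmxA ipE mul_scalar_mx scalerA. Qed.

Lemma mul_rw_root a w : a != 0 -> a *m rw a w = w *: a.
Proof.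
move=> a0; rewrite mul_rw divfK ?ip_eq0 // scalerBl scale1r addrC subrK //.
Qed.

Lemma rw1 a : rw a 1 = 1%:M.
Proof. by rewrite /rw subrr mul0r scale0r addr0. Qed.

Lemma row_ext m (A B : 'M[C]_(n, m)) : (forall x : 'rV_n, x *m A = x *m B) -> A = B.
Proof. by move=> h; apply/row_matrixP => i; rewrite !rowE h. Qed.

Lemma rwM a w w' : a != 0 -> rw a w *m rw a w' = rw a (w * w').
Proof.
move=> a0; apply: row_ext => x; rewrite mulmxA !mul_rw.
rewrite ipDl ipZl -addrA -scalerDl; congr (_ + _ *: _).
have : ip a a != 0 by rewrite ip_eq0.
by move: (ip a a) (ip x a) => N t N0; field.
Qed.

Lemma rw_inj a : a != 0 -> injective (rw a).
Proof.
move=> a0 w w' e; have := mul_rw_root w a0; rewrite e mul_rw_root // => /eqP.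
by rewrite -subr_eq0 -scalerBl scaler_eq0 (negPf a0) orbF subr_eq0 => /eqP.
Qed.

Lemma rw_scale (c : C) a w : c != 0 -> rw (c *: a) w = rw a w.
Proof.
move=> c0; apply: row_ext => x; rewrite !mul_rw ipZl !ipZr scalerA.
have [->|a0] := eqVneq a 0; first by rewrite !scaler0.
congr (_ + _ *: _); have : ip a a != 0 by rewrite ip_eq0.
have : c^* != 0 by rewrite conjC_eq0.
by move: (ip a a) (ip x a) (c^*) => N t d d0 N0; field; rewrite N0 d0 c0.
Qed.

Lemma adj_rw a w : adj (rw a w) = rw a w^*.
Proof.
apply/matrixP => i j; rewrite adjE !mxE !big_ord1 !adjE.
rewrite rmorphD !rmorphM fmorphV rmorphB rmorph1 /= -ipC conjCK eq_sym rmorph_nat.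
by rewrite [a 0 j * _]mulrC.
Qed.

Lemma rw_unitary a w : a != 0 -> w * w^* = 1 -> rw a w \is unitarymx.
Proof.
by move=> a0 w1; apply/unitarymxP; rewrite -/(adj _) adj_rw rwM // w1 rw1.
Qed.

Lemma unitary_rw g a : g \is unitarymx -> a != 0 -> (g - 1%:M <= a)%MS ->
  exists w, g = rw a w.
Proof.
move=> ug a0 /submxP[u e]; have N0 : ip a a != 0 by rewrite ip_eq0.
have gE : g = 1%:M + u *m a by rewrite -e addrC subrK.
have agE : adj g = 1%:M + adj a *m adj u.
  by rewrite gE -adjM; apply/matrixP => i j; rewrite !(adjE, mxE) rmorphD rmorph_nat eq_sym.
(* Multiplied on the right by [adj a], unitarity says that [u] times the norm of [a] is a multiple
   of [adj a]; this determines the column [u]. *)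
have : adj g *m g = 1%:M by apply: mulmx1C; apply/unitarymxP.
rewrite agE {1}gE mulmxDl mul1mx mulmxDr mulmx1 -addrA.
rewrite -[X in _ = X -> _]addr0 => /addrI /(congr1 (mulmx^~ (adj a))).
rewrite mul0mx !mulmxDl -!mulmxA ipE.
rewrite (mulmxA (adj u)) [adj u *m u]mx11_scalar.
rewrite [adj u *m adj a]mx11_scalar !mul_scalar_mx !mul_mx_scalar -!scalemxAr mul_mx_scalar.
move: (_ 0 0) (_ 0 0) => q p h.
have uE : u = (- (p + q * ip a a) / ip a a) *: adj a.
  apply: (scalerI N0); rewrite scalerA mulrC divfK // scaleNr.
  by apply/eqP; rewrite -addr_eq0 scalerDl -scalerA -h.
exists (1 - (p + q * ip a a)).
by rewrite gE uE /rw addrAC subrr add0r -scalemxAl.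
Qed.

Definition fker a : {vspace 'cV[C]_n} := lker (linfun (mulmx a)).

Lemma fkerP a v : (v \in fker a) = (a *m v == 0).
Proof. by rewrite memv_ker lfunE. Qed.

(** The columns of [cokermx a] lie in the kernel of [a], so testing [B] on them suffices. *)
Lemma fker_submx m (B : 'M[C]_(m, n)) a :
  (forall v, v \in fker a -> B *m v = 0) -> (B <= a)%MS.
Proof.
move=> h; rewrite submxE; apply/eqP/matrixP => i j.
have /(congr1 (fun M : 'cV_m => M i 0)) : B *m col j (cokermx a) = 0.
  by apply: h; rewrite fkerP colE mulmxA mulmx_coker mul0mx.
by rewrite colE mulmxA -colE !mxE.
Qed.

Lemma fker_sub_ker1 a g : (fker a <= ker1 g)%VS -> (g - 1%:M <= a)%MS.
Proof.
move=> /subvP h; apply: fker_submx => v /h; rewrite ker1P => /eqP e.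
by rewrite mulmxBl mul1mx e subrr.
Qed.

Lemma fker_eqP a b : fker a = fker b -> exists c, b = c *: a.
Proof. by move=> e; apply/sub_rVP; apply: fker_submx => v; rewrite e fkerP => /eqP. Qed.

Lemma fkerZ (c : C) a : c != 0 -> fker (c *: a) = fker a.
Proof.
move=> c0; apply/vspaceP => v; rewrite !fkerP -scalemxAl scaler_eq0.
by rewrite (negPf c0).
Qed.

Lemma ker1_rw a w : a != 0 -> w != 1 -> ker1 (rw a w) = fker a.
Proof.
move=> a0 w1; have N0 : ip a a != 0 by rewrite ip_eq0.
apply/vspaceP => v; rewrite ker1P fkerP /rw mulmxDl mul1mx -subr_eq0 addrC addKr.
rewrite -scalemxAl scaler_eq0 mulf_eq0 subr_eq0 (negPf w1) invr_eq0 (negPf N0) /=.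
apply/eqP/eqP => [h|h]; last by rewrite -mulmxA h mulmx0.
have := congr1 (mulmx a) h; rewrite mulmx0 !mulmxA ipE mul_scalar_mx -scalemxAl => /eqP.
by rewrite scaler_eq0 (negPf N0) => /eqP.
Qed.

Lemma dim_fker a : a != 0 -> (\dim (fker a)).+1 = n.
Proof.
move=> a0; pose f : 'Hom('cV[C]_n, 'cV[C]_1) := linfun (mulmx a).
have := limg_ker_dim f fullv; rewrite capfv -[lker f]/(fker a) dimvf /dim /= muln1.
suff -> : \dim (limg f) = 1%N by rewrite addn1.
apply/eqP; rewrite eqn_leq; apply/andP; split.
  by have := dimvS (subvf (limg f)); rewrite dimvf /dim /=.
rewrite lt0n dimv_eq0; apply: contra a0 => /eqP h0.
have : f (adj a) \in limg f by rewrite memv_img ?memvf.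
rewrite h0 memv0 lfunE /= ipE => /eqP/matrixP/(_ 0 0); rewrite !mxE eqxx mulr1n.
by move/eqP; rewrite ip_eq0.
Qed.

Lemma hact_fker a g : g \in unitmx -> hact g (fker (a *m g)) = fker a.
Proof.
move=> ug; apply/vspaceP => v; apply/memv_imgP/idP => [[u]|].
  by rewrite !fkerP lfunE /= => h ->; rewrite mulmxA.
move=> h; exists (invmx g *m v); last by rewrite lfunE /= mulKVmx.
by rewrite fkerP -mulmxA mulKVmx // -fkerP.
Qed.

Lemma rw_mul_unitary a g w : g \is unitarymx -> rw (a *m g) w = invmx g *m rw a w *m g.
Proof.
move=> ug; rewrite invmx_unitary // -/(adj g) /rw.
have -> : ip (a *m g) (a *m g) = ip a a.
  by rewrite /ip adjM mulmxA -(mulmxA a) (unitarymxP _) ?mulmx1.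
rewrite adjM mulmxDr mulmx1 mulmxDl -scalemxAr -scalemxAl !mulmxA; congr (_ + _).
by apply/esym/mulmx1C/unitarymxP.
Qed.

(** The row [v g - v] vanishes on the fixed space of [g]; both kernels have codimension 1, so it is
    a root of [g]. *)
Lemma reflection_moves g v : g \is unitarymx -> is_reflection g -> v *m g != v ->
  exists w, g = rw (v *m g - v) w.
Proof.
move=> ug [_ dg] vg; set d := v *m g - v.
have d0 : d != 0 by rewrite subr_eq0.
have e : ker1 g = fker d.
  apply/eqP; rewrite eqEdim; apply/andP; split.
    apply/subvP => x; rewrite ker1P fkerP => /eqP h.
    by rewrite /d mulmxBl -mulmxA h subrr.
  by have := dim_fker d0; rewrite -{3}dg => -[->].
by apply: unitary_rw => //; apply: fker_sub_ker1; rewrite e.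
Qed.

(** The image of [v] determines the factor [(w - 1) / ip a a]. Scaling by [ip v a] removes the
    division, in the form tested by [moves_check]. *)
Lemma rw_moves a (v : 'rV[C]_n) w x : a != 0 -> v *m rw a w = v + a ->
  ip v a *: (x *m rw a w) = ip v a *: x + ip x a *: a.
Proof.
move=> a0; rewrite !mul_rw => /addrI e.
have {e} : (w - 1) / ip a a * ip v a = 1.
  by apply/eqP; rewrite -subr_eq0 -[_ == 0]orbF -(negPf a0) -scaler_eq0 scalerBl e scale1r subrr.
move: ((w - 1) / ip a a) => c e; rewrite scalerDr scalerA; congr (_ + _ *: _).
by rewrite mulrA [_ * c]mulrC e mul1r.
Qed.

Lemma rw_eigenvalue a (v : 'rV[C]_n) w w' :
  v *m rw a w != v -> v *m rw a w = v *m rw a w' -> w = w'.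
Proof.
rewrite !mul_rw -subr_eq0 addrC addKr => h /addrI/eqP.
rewrite -subr_eq0 -scalerBl -mulrBl -mulrBl scaler_eq0 !mulf_eq0.
move: h; rewrite scaler_eq0 !mulf_eq0 !negb_or.
case/andP => /andP[/andP[_ /negPf ->] /negPf ->] /negPf ->.
by rewrite !orbF opprB addrA subrK subr_eq0 => /eqP.
Qed.

End UnitaryReflections.

(** * Eisenstein integers *)

(** The pair [(a, b)] encodes the Eisenstein integer [a + b zeta]. *)
Definition ei : Type := (BinInt.Z * BinInt.Z)%type.

Definition ei_int (a : BinInt.Z) : ei := (a, BinInt.Z0).
Definition ei_add (x y : ei) : ei := (BinInt.Z.add x.1 y.1, BinInt.Z.add x.2 y.2).
Definition ei_opp (x : ei) : ei := (BinInt.Z.opp x.1, BinInt.Z.opp x.2).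
Definition ei_mul (x y : ei) : ei :=
  let t := BinInt.Z.mul x.2 y.2 in
  (BinInt.Z.sub (BinInt.Z.mul x.1 y.1) t,
   BinInt.Z.sub (BinInt.Z.add (BinInt.Z.mul x.1 y.2) (BinInt.Z.mul x.2 y.1)) t).
Definition ei_conj (x : ei) : ei := (BinInt.Z.sub x.1 x.2, BinInt.Z.opp x.2).
Definition ei_eq (x y : ei) : bool := BinInt.Z.eqb x.1 y.1 && BinInt.Z.eqb x.2 y.2.
Definition ei_root (k : nat) : ei :=
  match k with
  | 0 => ei_int (BinInt.Z.of_nat 1)
  | 1 => (BinInt.Z0, BinInt.Z.of_nat 1)
  | _ => (BinInt.Z.opp (BinInt.Z.of_nat 1), BinInt.Z.opp (BinInt.Z.of_nat 1))
  end.

Definition evec : Type := (ei * ei * ei)%type.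

Definition ev_coord (v : evec) (i : nat) : ei :=
  match i with 0 => v.1.1 | 1 => v.1.2 | _ => v.2 end.
Definition ev_of (f : nat -> ei) : evec := (f 0, f 1, f 2).
Definition ev_add (u v : evec) : evec :=
  ev_of (fun i => ei_add (ev_coord u i) (ev_coord v i)).
Definition ev_scale (c : ei) (v : evec) : evec :=
  ev_of (fun i => ei_mul c (ev_coord v i)).
Definition ev_dot (u v : evec) : ei :=
  let m i := ei_mul (ev_coord u i) (ei_conj (ev_coord v i)) in
  ei_add (ei_add (m 0) (m 1)) (m 2).
Definition ev_eq (u v : evec) : bool :=
  [&& ei_eq u.1.1 v.1.1, ei_eq u.1.2 v.1.2 & ei_eq u.2 v.2].
Definition ev_sub (u v : evec) := ev_add u (ev_scale (ei_opp (ei_root 0)) v).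
Definition ev_cross (u v : evec) : evec :=
  let m i j := ei_add (ei_mul (ev_coord u i) (ev_coord v j))
                      (ei_opp (ei_mul (ev_coord u j) (ev_coord v i))) in
  (m 1 2, m 2 0, m 0 1).
Definition ev_zero : evec := ev_of (fun=> ei_int BinInt.Z0).
Definition ev_par (u v : evec) : bool := ev_eq (ev_cross u v) ev_zero.
Definition ev_det (u v w : evec) : ei :=
  let x := ev_cross u v in
  let m i := ei_mul (ev_coord x i) (ev_coord w i) in
  ei_add (ei_add (m 0) (m 1)) (m 2).

Section Eisenstein.
Variables (C : numClosedFieldType) (z : C).
Hypothesis hz : z ^+ 2 + z + 1 = 0.

Lemma z2 : z ^+ 2 = - z - 1.
Proof. by apply/eqP; rewrite -subr_eq0 -hz; apply/eqP; ring. Qed.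

Lemma z3 : z ^+ 3 = 1.
Proof. by rewrite exprS z2 mulrBr mulrN -expr2 z2; ring. Qed.

Lemma conj_z : z^* = z ^+ 2.
Proof.
have z0 : z != 0 by apply/eqP => z0; move: z3; rewrite z0 expr0n => /eqP; rewrite eq_sym oner_eq0.
have n1 : `|z| = 1.
  by apply/eqP; rewrite -(@pexpr_eq1 _ _ 3) // -normrX z3 normr1.
apply: (mulfI z0); rewrite -normCK n1 expr1n -exprS z3 //.
Qed.

Lemma z_neq : z - z ^+ 2 != 0.
Proof.
(* Division with remainder by the minimal polynomial: the square of [z - z^2] is -3. *)
apply/eqP => h; have : (z - z ^+ 2) ^+ 2 = (z ^+ 2 + z + 1) * (z ^+ 2 - 3 * z + 3) - 3.
  by ring.
by rewrite h hz mul0r expr0n add0r => /eqP; rewrite eq_sym oppr_eq0 pnatr_eq0.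
Qed.

Definition cz (a : BinInt.Z) : C := (int_of_Z a)%:~R.

Lemma czD a b : cz (BinInt.Z.add a b) = cz a + cz b.
Proof. by rewrite /cz -intrD -rmorphD. Qed.
Lemma czN a : cz (BinInt.Z.opp a) = - cz a.
Proof. by rewrite /cz -intrN -rmorphN. Qed.
Lemma czB a b : cz (BinInt.Z.sub a b) = cz a - cz b.
Proof. by rewrite -czN -czD. Qed.
Lemma czM a b : cz (BinInt.Z.mul a b) = cz a * cz b.
Proof. by rewrite /cz -intrM -rmorphM. Qed.
Lemma cz_eq a b : BinInt.Z.eqb a b = (cz a == cz b).
Proof. by rewrite eqr_int (inj_eq (can_inj int_of_ZK)). Qed.

Definition ce (x : ei) : C := cz x.1 + cz x.2 * z.

Lemma ceD x y : ce (ei_add x y) = ce x + ce y.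
Proof. by rewrite /ce !czD; ring. Qed.
Lemma ceN x : ce (ei_opp x) = - ce x.
Proof. by rewrite /ce !czN; ring. Qed.
Lemma ceM x y : ce (ei_mul x y) = ce x * ce y.
Proof.
have e (a b c d : C) :
    (a + b * z) * (c + d * z) = a * c + (a * d + b * c) * z + b * d * z ^+ 2 by ring.
by rewrite /ce /= !(czB, czD, czM) e z2; ring.
Qed.
Lemma ce_conj x : ce (ei_conj x) = (ce x)^*.
Proof.
rewrite /ce rmorphD rmorphM /= conj_z z2 !rmorph_int -/(cz _) -/(cz _) czB czN.
by ring.
Qed.
(** Subtracting the complex conjugate isolates the [zeta] coordinate. This injectivity lets boolean
    computations also prove that complex numbers differ. *)
Lemma ce_eq0 x : ce x = 0 -> x = ei_int BinInt.Z0.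
Proof.
move=> h; have := congr1 Num.conj h; rewrite /ce rmorphD rmorphM rmorph0 /= conj_z.
rewrite !rmorph_int -/(cz _) -/(cz _) => h'.
have : cz x.2 * (z - z ^+ 2) = 0.
  rewrite -[RHS](subrr 0) -{1}h -h' /ce; ring.
move/eqP; rewrite mulf_eq0 (negPf z_neq) orbF => /eqP e2.
move: h; rewrite /ce e2 mul0r addr0 => e1.
case: x e1 e2 {h'} => a b /= /eqP + /eqP; rewrite /cz !intr_eq0.
by move=> /eqP/(congr1 Z_of_int) + /eqP/(congr1 Z_of_int); rewrite !int_of_ZK => -> ->.
Qed.
Lemma ei_eqE x y : ei_eq x y = (ce x == ce y).
Proof.
apply/andP/eqP => [[]|h].
  by rewrite !cz_eq /ce => /eqP -> /eqP ->.
have : ce (ei_add x (ei_opp y)) = 0 by rewrite ceD ceN h subrr.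
by move/ce_eq0 => [e1 e2]; split; rewrite cz_eq -subr_eq0 -czN -czD ?e1 ?e2.
Qed.
Lemma ce0 : ce (ei_int BinInt.Z0) = 0.
Proof. by rewrite /ce /= mul0r addr0. Qed.
Lemma ce_root k : (k < 3)%N -> ce (ei_root k) = z ^+ k.
Proof.
have c1 : cz (BinNums.Zpos BinNums.xH) = 1 by [].
have cN1 : cz (BinNums.Zneg BinNums.xH) = -1 by [].
case: k => [|[|[|]]] // _; rewrite /ce /= ?cN1 ?c1 ?expr0 ?expr1.
- by rewrite mul0r addr0.
- by rewrite mul1r add0r.
- by rewrite z2; ring.
Qed.

Definition cv (v : evec) : 'rV[C]_3 := \row_(j < 3) ce (ev_coord v j).

Lemma cvP (f : nat -> ei) : cv (ev_of f) = \row_(j < 3) ce (f j).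
Proof. by apply/rowP => -[[|[|[|]]] //= i]; rewrite !mxE. Qed.
Lemma cvD u v : cv (ev_add u v) = cv u + cv v.
Proof. by rewrite cvP; apply/rowP => j; rewrite !mxE ceD. Qed.
Lemma cvZ c v : cv (ev_scale c v) = ce c *: cv v.
Proof. by rewrite cvP; apply/rowP => j; rewrite !mxE ceM. Qed.
Lemma cvB u v : cv (ev_sub u v) = cv u - cv v.
Proof. by rewrite cvD cvZ ceN (ce_root (k := 0)) // expr0 scaleN1r. Qed.
Lemma cv0 : cv ev_zero = 0.
Proof. by rewrite cvP; apply/rowP => j; rewrite !mxE ce0. Qed.
Lemma ev_eqE u v : ev_eq u v = (cv u == cv v).
Proof.
rewrite /ev_eq !ei_eqE; apply/and3P/eqP => [[/eqP h1 /eqP h2 /eqP h3]|h].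
  by apply/rowP => -[[|[|[|]]] //= i]; rewrite !mxE.
have e k (hk : (k < 3)%N) : ce (ev_coord u k) = ce (ev_coord v k).
  by have := congr1 (fun M : 'rV[C]_3 => M 0 (Ordinal hk)) h; rewrite !mxE.
by split; apply/eqP; [exact: (e 0)|exact: (e 1)|exact: (e 2)].
Qed.
Lemma ev_dotE u v : ce (ev_dot u v) = ip (cv u) (cv v).
Proof.
by rewrite ip_sum !big_ord_recl big_ord0 !mxE /= addr0 addrA !ceD !ceM !ce_conj.
Qed.

Lemma ev_parP u v : ~~ ev_eq u ev_zero ->
  reflect (exists c, cv v = c *: cv u) (ev_par u v).
Proof.
move=> u0; rewrite /ev_par ev_eqE cv0; apply: (iffP eqP) => [h|[c h]].
  have e k (hk : (k < 3)%N) : ce (ev_coord (ev_cross u v) k) = 0.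
    by have := congr1 (fun M : 'rV[C]_3 => M 0 (Ordinal hk)) h; rewrite !mxE.
  move: (e 0 isT) (e 1 isT) (e 2 isT).
  rewrite /= !(ceD, ceN, ceM) => /subr0_eq e0 /subr0_eq e1 /subr0_eq e2.
  have [j uj] : exists j : 'I_3, ce (ev_coord u j) != 0.
    apply/existsP; apply: contraR u0; rewrite negb_exists ev_eqE cv0 => /forallP hu.
    by apply/eqP/rowP => j; rewrite !mxE; apply/eqP/negPn/hu.
  exists (ce (ev_coord v j) / ce (ev_coord u j)); apply/rowP => k; rewrite !mxE.
  apply: (mulfI uj); rewrite mulrCA mulrA divfK //.
  case: j {uj} => [[|[|[|]]] //= ?]; case: k => [[|[|[|]]] //= ?]; rewrite /=;
    first [by rewrite mulrC | by rewrite [RHS]mulrC ?(e0, e1, e2)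
          | by rewrite [RHS]mulrC -?(e0, e1, e2)].
have e k : (k < 3)%N -> ce (ev_coord v k) = c * ce (ev_coord u k).
  by move=> hk; have := congr1 (fun M : 'rV[C]_3 => M 0 (Ordinal hk)) h; rewrite !mxE.
by apply/rowP => -[[|[|[|]]] //= i]; rewrite !mxE /= !(ceD, ceN, ceM) !(e 0, e 1, e 2) //; ring.
Qed.

End Eisenstein.

(** * The mirrors of G_26 *)

Local Open Scope nat_scope.

Definition ev_unit (i : nat) : evec := ev_of (fun j => ei_int (BinInt.Z.of_nat (i == j))).

Definition ev_diff (i j k : nat) : evec := ev_sub (ev_unit i) (ev_scale (ei_root k) (ev_unit j)).

Definition ev_sum (k l : nat) : evec := (ei_root 0, ei_root k, ei_root l).

(** The first twelve roots are those of the reflections of order 3. *)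
Definition mirror_roots : seq evec := Eval vm_compute in
  [seq ev_unit i | i <- iota 0 3] ++
  [seq ev_sum k l | k <- iota 0 3, l <- iota 0 3] ++
  [seq ev_diff p.1 p.2 k | p <- [:: (0, 1); (0, 2); (1, 2)], k <- iota 0 3].

Definition mroot (i : nat) : evec := nth (ev_unit 0) mirror_roots i.

Definition ei_m1 : ei := ei_opp (ei_root 0).

(** Positions [2 i] and [2 i + 1] hold the reflections of root [i < 12] with eigenvalue [zeta] and
    [zeta^2]; positions 24 to 32 hold those of order 2. *)
Definition refl_data : seq (nat * ei) := Eval vm_compute in
  [seq (i, ei_root k) | i <- iota 0 12, k <- iota 1 2] ++
  [seq (i, ei_m1) | i <- iota 12 9].

Definition ei_units : seq ei :=
  [seq ei_mul e (ei_root k) | e <- [:: ei_root 0; ei_m1], k <- iota 0 3].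

(** The multiples by units of the roots of order 2 are permuted by [G_26] and
    span [C^3]. *)
Definition short_vectors : seq evec := Eval vm_compute in
  [seq ev_scale u (mroot i) | i <- iota 12 9, u <- ei_units].

Definition root_norm (i : nat) : ei := ev_dot (mroot i) (mroot i).

(** The image of the row [x] under the reflection [s], multiplied by the norm
    of its root so as to stay in the Eisenstein integers. *)
Definition rimg (s : nat * ei) (x : evec) : evec :=
  let a := mroot s.1 in
  ev_add (ev_scale (root_norm s.1) x)
    (ev_scale (ei_mul (ei_add s.2 ei_m1) (ev_dot x a)) a).

Definition stable_check (s : nat * ei) := let N := root_norm s.1 in
  let l := [seq ev_scale N y | y <- short_vectors] in
  all (fun x => let r := rimg s x in has (ev_eq r) l) short_vectors.

Lemma short_vectors_stable : all stable_check refl_data.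
Proof. by vm_compute. Qed.

(** With [d = v' - v], the only map which can be a unitary reflection taking [v]
    to [v'] is [x |-> x + (<x, d> / <v, d>) d]: it is one of the 33 known
    reflections, or does not preserve the short vectors. *)
Definition moves_check (v v' : evec) := let d := ev_sub v' v in let c := ev_dot v d in
  [|| ev_eq v' v,
      has (fun s => ev_par (mroot s.1) d
             && ev_eq (ev_scale (root_norm s.1) v') (rimg s v)) refl_data
    | let l := [seq ev_scale c y | y <- short_vectors] in
      has (fun x => let r := ev_add (ev_scale c x) (ev_scale (ev_dot x d) d) in
             all (fun y => ~~ ev_eq r y) l) short_vectors].

(** Three independent short vectors: every reflection moves one of them. *)
Definition basis_vectors := Eval vm_compute in [:: ev_diff 0 1 0; ev_diff 0 1 1; ev_diff 1 2 0].

Lemma short_vectors_moves :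
  all (fun v => all (moves_check v) short_vectors) basis_vectors.
Proof. by vm_compute. Qed.

(** A vanishing determinant means that a third mirror contains the intersection. Only this direction
    is proved; where the test fails, transversality is settled by classical case analysis. *)
Definition nontransverse i j := (i != j) &&
  has (fun k => [&& k != i, k != j &
    ei_eq (ev_det (mroot i) (mroot j) (mroot k)) (ei_int BinInt.Z0)]) (iota 0 21).

(** B5 thus covers all pairs of mirrors of equal order, leaving the pairs of different orders. *)
Lemma nontransverse_same : all (fun i => all (fun j =>
  (i == j) || ((i < 12) != (j < 12)) || nontransverse i j) (iota 0 21)) (iota 0 21).
Proof. by vm_compute. Qed.

Lemma roots_indep : all (fun i => all (fun j =>
  (i == j) || ~~ ev_par (mroot i) (mroot j)) (iota 0 21)) (iota 0 21).
Proof. by vm_compute. Qed.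

Local Close Scope nat_scope.

(** The default is the first entry, so facts about all entries hold for every index without a bound;
    likewise for [mroot]. *)
Definition rdat (n : nat) : nat * ei := nth (0, ei_root 1)%N refl_data n.

Lemma root_all (P : evec -> bool) : all P mirror_roots -> forall i, P (mroot i).
Proof.
move=> h i; have [hi|hi] := ltnP i (size mirror_roots); first exact: (allP h) (mem_nth _ hi).
rewrite /mroot nth_default //; exact: (allP h).
Qed.

Lemma rdat_all (P : nat * ei -> bool) : all P refl_data -> forall n, P (rdat n).
Proof.
move=> h n; have [hi|hi] := ltnP n (size refl_data); first exact: (allP h) (mem_nth _ hi).
rewrite /rdat nth_default //; exact: (allP h).
Qed.

Lemma root_neq0 i : ~~ ev_eq (mroot i) ev_zero.
Proof. exact: (@root_all (fun v => ~~ ev_eq v ev_zero) isT i). Qed.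

Lemma all2_iota m (P : nat -> nat -> bool) :
  all (fun i => all (P i) (iota 0 m)) (iota 0 m) ->
  forall i j, (i < m)%N -> (j < m)%N -> P i j.
Proof.
move=> /allP h i j hi hj; have /h/allP : i \in iota 0 m by rewrite mem_iota.
by apply; rewrite mem_iota.
Qed.

(** * Reflections and finiteness of a group generated by the listed reflections *)

Section Mirrors.
Variables (C : numClosedFieldType) (z : C).
Hypothesis hz : z ^+ 2 + z + 1 = 0.
Implicit Types (a b : 'rV[C]_3) (g : 'M[C]_3).

Local Notation cv := (cv z).
Local Notation ce := (ce z).

Definition refl_mx (n : nat) : 'M[C]_3 := rw (cv (mroot (rdat n).1)) (ce (rdat n).2).
Definition mirror (i : nat) : {vspace 'cV[C]_3} := fker (cv (mroot i)).

Lemma cv_neq0 v : ~~ ev_eq v ev_zero -> cv v != 0.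
Proof. by rewrite (ev_eqE hz) (cv0 z). Qed.

Lemma cv_root_neq0 i : cv (mroot i) != 0.
Proof. exact/cv_neq0/root_neq0. Qed.

Lemma eigenvalue_neq1 n : ce (rdat n).2 != 1.
Proof.
have := @rdat_all (fun s => ~~ ei_eq s.2 (ei_root 0)) isT n.
by rewrite (ei_eqE hz) (ce_root hz (k := 0)).
Qed.

Lemma eigenvalue_norm n : ce (rdat n).2 * (ce (rdat n).2)^* = 1.
Proof.
have := @rdat_all (fun s => ei_eq (ei_mul s.2 (ei_conj s.2)) (ei_root 0)) isT n.
by rewrite (ei_eqE hz) (ceM hz) (ce_conj hz) (ce_root hz (k := 0)) // => /eqP.
Qed.

Lemma rmat_unitary n : refl_mx n \is unitarymx.
Proof. exact: rw_unitary (cv_root_neq0 _) (eigenvalue_norm n). Qed.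

Lemma rmat_unit n : refl_mx n \in unitmx.
Proof. exact/unitarymx_unit/rmat_unitary. Qed.

Lemma ker1_rmat n : ker1 (refl_mx n) = mirror (rdat n).1.
Proof. exact: ker1_rw (cv_root_neq0 _) (eigenvalue_neq1 n). Qed.

Lemma rmat_reflection n : is_reflection (refl_mx n).
Proof. by split; rewrite ?rmat_unit // ker1_rmat dim_fker ?cv_root_neq0. Qed.

Lemma root_normE i : ce (root_norm i) = ip (cv (mroot i)) (cv (mroot i)).
Proof. exact: ev_dotE. Qed.

Lemma root_norm_neq0 i : ce (root_norm i) != 0.
Proof. by rewrite root_normE ip_eq0 cv_root_neq0. Qed.

Lemma cv_rimg s x : cv (rimg s x) =
  ce (root_norm s.1) *: (cv x *m rw (cv (mroot s.1)) (ce s.2)).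
Proof.
have N0 : ip (cv (mroot s.1)) (cv (mroot s.1)) != 0 by rewrite ip_eq0 cv_root_neq0.
rewrite (cvD z) !(cvZ hz) (ceM hz) !(ev_dotE hz) mul_rw scalerDr scalerA.
rewrite ceD ceN (ce_root hz (k := 0)) // expr0; congr (_ + _ *: _).
by move: N0; set N := ip _ _; set t := ip _ _ => N0; field.
Qed.

Lemma basis_ext m (A B : 'M[C]_(3, m)) :
  {in basis_vectors, forall v, cv v *m A = cv v *m B} -> A = B.
Proof.
pose b1 := ev_diff 0 1 0; pose b2 := ev_diff 0 1 1; pose b3 := ev_diff 1 2 0.
move=> h; have h1 : cv b1 *m A = cv b1 *m B by exact: h.
have h2 : cv b2 *m A = cv b2 *m B by exact: h.
have h3 : cv b3 *m A = cv b3 *m B by exact: h.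
have c0 : ce (ei_add (ei_root 0) (ei_opp (ei_root 1))) != 0.
  by rewrite -(ce0 z) -(ei_eqE hz); vm_compute.
pose c := ei_add (ei_root 0) (ei_opp (ei_root 1)).
(* With [c = 1 - zeta]: [c e_0 = - zeta b1 + b2], [c e_1 = - b1 + b2] and
   [c e_2 = - b1 + b2 - c b3]. *)
have dec (t : 'I_3) : exists p, ev_eq (ev_scale c (ev_unit t))
    (ev_add (ev_add (ev_scale p.1 b1) b2) (ev_scale p.2 b3)).
  case: t => [[|[|[|]]] // ?].
  - by exists (ei_opp (ei_root 1), ei_int BinInt.Z0); vm_compute.
  - by exists (ei_m1, ei_int BinInt.Z0); vm_compute.
  - by exists (ei_m1, ei_opp c); vm_compute.
move: b1 b2 b3 dec h1 h2 h3 => b1 b2 b3 dec h1 h2 h3.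
have fixu (t : 'I_3) : cv (ev_unit t) *m A = cv (ev_unit t) *m B.
  have [p] := dec t; rewrite (ev_eqE hz) (cvZ hz) !cvD !(cvZ hz) => /eqP e.
  apply: (scalerI c0); rewrite !scalemxAl e !mulmxDl -!scalemxAl.
  by rewrite h1 h2 h3.
apply: row_ext => x; rewrite (row_sum_delta x) !mulmx_suml; apply: eq_bigr => t _.
have <- : cv (ev_unit t) = delta_mx 0 t.
  apply/rowP => j; rewrite !mxE eqxx /=; rewrite /ev_unit.
  have -> : ev_coord (ev_of (fun j0 => ei_int (BinInt.Z.of_nat (t == j0 :> nat)))) j
     = ei_int (BinInt.Z.of_nat (t == j :> nat)) by case: j => [[|[|[|]]] // ?].
  rewrite [j == t]eq_sym -val_eqE /=; case: eqP => _ /=; last exact: ce0.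
  exact: (ce_root hz (k := 0)).
by rewrite -!scalemxAl fixu.
Qed.

Lemma short_vector_img n x : x \in short_vectors ->
  exists2 y, y \in short_vectors & cv x *m refl_mx n = cv y.
Proof.
move=> hx; have /allP/(_ _ hx) := rdat_all short_vectors_stable n.
case/hasP => _ /mapP[y hy ->]; rewrite (ev_eqE hz) cv_rimg (cvZ hz) => /eqP e.
by exists y => //; apply: (scalerI (root_norm_neq0 (rdat n).1)).
Qed.

Variable W : set 'M[C]_3.
Hypothesis W1 : W 1%:M.
Hypothesis WM : forall g h, W g -> W h -> W (g *m h).
Hypothesis WV : forall g, W g -> W (invmx g).
Hypothesis Wgen : forall n, W (refl_mx n).
Hypothesis Wind : forall P : set 'M[C]_3, P 1%:M -> (forall n, P (refl_mx n)) ->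
  (forall g h, W g -> W h -> P g -> P h -> P (g *m h)) ->
  (forall g, W g -> P g -> P (invmx g)) -> forall g, W g -> P g.

Lemma unitarymx1 : (1%:M : 'M[C]_3) \is unitarymx.
Proof.
apply/unitarymxP; rewrite mul1mx; apply/matrixP => i j.
by rewrite !mxE eq_sym; exact: rmorph_nat.
Qed.

Lemma W_unitary g : W g -> g \is unitarymx.
Proof.
apply: (Wind (P := fun g => g \is unitarymx)); first exact: unitarymx1.
- exact: rmat_unitary.
- by move=> g1 g2 _ _; exact: mul_unitarymx.
- by move=> g1 _ u1; rewrite invmx_unitary // trmxC_unitary.
Qed.

Lemma W_unit g : W g -> g \in unitmx.
Proof. by move=> /W_unitary/unitarymx_unit. Qed.

Lemma W_short_vectors g : W g -> {in short_vectors, forall x,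
  exists2 y, y \in short_vectors & cv x *m g = cv y}.
Proof.
move=> Wg; move: g Wg; apply: Wind.
- by move=> x hx; exists x => //; rewrite mulmx1.
- by move=> n x hx; exact: short_vector_img.
- move=> g h _ _ Hg Hh x /Hg[y hy e]; have [t ht e'] := Hh _ hy.
  by exists t; rewrite // mulmxA e.
(* An injective self-map of the finite set of short vectors is onto, so the inverse preserves it
   too. *)
- move=> g Wg Hg y hy; pose s := undup (map cv short_vectors).
  have gu := W_unit Wg.
  have gi : injective (mulmx^~ g : 'rV[C]_3 -> 'rV[C]_3) by exact: can_inj (mulmxK gu).
  have [|||_ es] := @uniq_min_size _ (map (mulmx^~ g) s) s.
  + by rewrite map_inj_uniq // undup_uniq.
  + move=> u /mapP[v + ->]; rewrite !mem_undup => /mapP[x hx ->].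
    have [t ht e] := Hg _ hx; have -> : (mulmx^~ g) (cv x) = cv t by exact: e.
    exact: map_f.
  + by rewrite size_map.
  have : cv y \in s by rewrite mem_undup map_f.
  rewrite -es => /mapP[v]; rewrite mem_undup => /mapP[x hx ->] e.
  by exists x => //; rewrite e mulmxK.
Qed.

(** An element is determined by the images of three independent short vectors, which are short; [f]
    chooses an element for each triple of images. *)
Lemma W_finite : exists2 eW : seq 'M[C]_3, uniq eW & forall g, g \in eW <-> W g.
Proof.
pose img (g : 'M[C]_3) (p : evec * evec * evec) :=
  [/\ cv (ev_diff 0 1 0) *m g = cv p.1.1, cv (ev_diff 0 1 1) *m g = cv p.1.2
    & cv (ev_diff 1 2 0) *m g = cv p.2].
pose f p := xget 1%:M [set g | W g /\ img g p].
pose pairs := [seq (x, y) | x <- short_vectors, y <- short_vectors].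
pose l := [seq f p | p <- [seq (q, t) | q <- pairs, t <- short_vectors]].
exists (undup [seq g <- l | `[< W g >]]); first exact: undup_uniq.
move=> g; rewrite mem_undup mem_filter; split=> [/andP[/asboolP //]|Wg].
have /asboolP -> := Wg; rewrite andTb.
have [x hx e1] := W_short_vectors Wg (x := ev_diff 0 1 0) isT.
have [y hy e2] := W_short_vectors Wg (x := ev_diff 0 1 1) isT.
have [t ht e3] := W_short_vectors Wg (x := ev_diff 1 2 0) isT.
apply/mapP; exists (x, y, t); first by apply: allpairs_f => //; exact: allpairs_f.
have [_ [h1 h2 h3]] : W (f (x, y, t)) /\ img (f (x, y, t)) (x, y, t).
  by apply: (@xgetPex _ 1%:M [set g | W g /\ img g (x, y, t)]); exists g.
apply: basis_ext => v; rewrite !inE => /or3P[] /eqP ->.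
- exact: etrans e1 (esym h1).
- exact: etrans e2 (esym h2).
- exact: etrans e3 (esym h3).
Qed.

Lemma hform_inj i j : (i < 21)%N -> (j < 21)%N -> mirror i = mirror j -> i = j.
Proof.
move=> hi hj /fker_eqP e.
have : (i == j) || ~~ ev_par (mroot i) (mroot j) := all2_iota roots_indep hi hj.
by have /(ev_parP hz _ (root_neq0 i)) -> := e; rewrite orbF => /eqP.
Qed.

Lemma rdat_lt n : ((rdat n).1 < 21)%N.
Proof. exact: (@rdat_all (fun s => s.1 < 21)%N isT n). Qed.

Lemma rmat_inj n m : (n < 33)%N -> (m < 33)%N -> refl_mx n = refl_mx m -> n = m.
Proof.
move=> hn hm e; have e1 : (rdat n).1 = (rdat m).1.
  by apply: hform_inj; rewrite ?rdat_lt // -!ker1_rmat e.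
have e2 : (rdat n).2 = (rdat m).2.
  move: e; rewrite /refl_mx e1 => /(rw_inj (cv_root_neq0 _))/eqP.
  rewrite -(ei_eqE hz) => /andP[/BinInt.Z.eqb_eq + /BinInt.Z.eqb_eq].
  by case: (rdat n).2 (rdat m).2 => ? ? [? ?] /= -> ->.
apply/eqP; rewrite -(nth_uniq (0, ei_root 1)%N (s := refl_data)) //.
by rewrite -/(rdat n) -/(rdat m) [rdat n]surjective_pairing e1 e2 -surjective_pairing.
Qed.

(** Some basis vector [v] is moved to a short vector [v'], and [v' - v] is then a root. Of the
    alternatives of [moves_check] the first says that [v] is fixed and the last contradicts the
    stability of the short vectors. *)
Lemma refl_class g : W g -> is_reflection g -> exists2 n, (n < 33)%N & g = refl_mx n.
Proof.
move=> Wg rg.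
have [v vb vg] : exists2 v, v \in basis_vectors & cv v *m g != cv v.
  have [/hasP[v]|/hasPn h] := boolP (has (fun v => cv v *m g != cv v) basis_vectors).
    by exists v.
  have g1 : g = 1%:M.
    by apply: basis_ext => v /h; rewrite negbK mulmx1 => /eqP.
  case: rg; rewrite g1 => _ h3; move: (h3); have -> : ker1 (1%:M : 'M[C]_3) = fullv.
    by apply/vspaceP => v; rewrite ker1P mul1mx eqxx memvf.
  by rewrite dimvf /dim /= muln1.
have vs : v \in short_vectors.
  by move: v vb {vg}; apply/allP; vm_compute.
have [v' v's e] := W_short_vectors Wg vs.
have [w gE] := reflection_moves (W_unitary Wg) rg vg.
have := allP (allP short_vectors_moves _ vb) _ v's; rewrite /moves_check.
move: gE; rewrite e -(cvB hz); set d := ev_sub v' v => gE.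
case/or3P => [|/hasP[s sr /andP[/(ev_parP hz _ (root_neq0 _))[c dc]]]|/hasP[x xs /allP h]].
- by rewrite (ev_eqE hz) -e (negPf vg).
- rewrite (ev_eqE hz) cv_rimg (cvZ hz) => /eqP/(scalerI (root_norm_neq0 _)) ev.
  have c0 : c != 0.
    apply: contra vg => /eqP c0; move: dc; rewrite c0 scale0r /d (cvB hz) e => /eqP.
    by rewrite subr_eq0.
  have gE' : g = rw (cv (mroot s.1)) w by rewrite gE dc rw_scale.
  have ew : w = ce s.2.
    by apply: (@rw_eigenvalue _ _ (cv (mroot s.1)) (cv v)); rewrite -gE' // e.
  exists (index s refl_data); first by rewrite (_ : 33 = size refl_data)%N // index_mem.
  by rewrite /refl_mx /rdat nth_index // gE' ew.
- have [y ys ey] := W_short_vectors Wg xs.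
  have := h _ (map_f _ ys); rewrite (ev_eqE hz) (cvD z) !(cvZ hz) !(ev_dotE hz) => /eqP[].
  rewrite -ey gE; apply/esym/rw_moves; rewrite -?gE ?e.
    by rewrite /d (cvB hz) subr_eq0 -e.
  by rewrite /d (cvB hz) addrC subrK.
Qed.

(** The direction is reversed because roots are rows acted on from the right: mirror [j] goes to
    mirror [k] when root [k] goes to a multiple of root [j]. *)
Definition maps n j k := ev_par (mroot j) (rimg (rdat n) (mroot k)).

Lemma mapsP n j k : reflect (hact (refl_mx n) (mirror j) = mirror k) (maps n j k).
Proof.
have u := rmat_unit n; have N0 := root_norm_neq0 (rdat n).1.
apply: (iffP idP) => [/(ev_parP hz _ (root_neq0 j))[c]|e].
  rewrite cv_rimg => e; have c0 : c != 0.
    apply: contraNneq (cv_root_neq0 k) => c0; move/eqP: e; rewrite c0 scale0r.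
    rewrite scaler_eq0 (negPf N0) /= => /eqP e.
    by rewrite -[cv _](mulmxK u) -/(refl_mx n) e mul0mx.
  rewrite -[mirror k](hact_fker (cv (mroot k)) u); congr hact; rewrite /mirror.
  by rewrite -(fkerZ (cv (mroot k) *m refl_mx n) N0) e fkerZ.
apply/(ev_parP hz _ (root_neq0 j)); rewrite cv_rimg.
have /fker_eqP[c ->] : fker (cv (mroot j)) = fker (cv (mroot k) *m refl_mx n).
  rewrite -[LHS](hactK _ u) e -[RHS](hactK _ u); congr hact.
  by rewrite hact_fker.
by exists (ce (root_norm (rdat n).1) * c); rewrite scalerA.
Qed.

(** Cramer's rule without division: a nonzero coordinate of the cross product of [a] and [b], times
    the form [c], is a combination of the forms [a] and [b] and of the determinant. *)
Lemma det_fker (a b c : evec) : ev_par a b = false -> ei_eq (ev_det a b c) (ei_int BinInt.Z0) ->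
  (fker (cv a) :&: fker (cv b) <= fker (cv c))%VS.
Proof.
rewrite (ei_eqE hz) (ce0 z) => ab /eqP d.
have dotE x (v : 'cV[C]_3) : (cv x *m v == 0) =
  (ce x.1.1 * v 0 0 + ce x.1.2 * v 1 0 + ce x.2 * v 2%:R 0 == 0).
  have -> : ce x.1.1 * v 0 0 + ce x.1.2 * v 1 0 + ce x.2 * v 2%:R 0 = (cv x *m v) 0 0.
    rewrite mxE !big_ord_recl big_ord0 !mxE /= addr0 addrA.
    by congr (_ + _ * v _ _ + _ * v _ _); apply: val_inj.
  by apply/eqP/eqP => [->|h]; [rewrite mxE|apply/matrixP => i j; rewrite !ord1 h mxE].
apply/subvP => v; rewrite memv_cap !fkerP !dotE => /andP[/eqP ha /eqP hb].
move: (v 0 0) (v 1 0) (v 2%:R 0) ha hb {dotE} => v0 v1 v2 ha hb.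
have crossP : [|| ce (ev_cross a b).1.1 != 0, ce (ev_cross a b).1.2 != 0
                | ce (ev_cross a b).2 != 0].
  move/negbT: ab; rewrite /ev_par /ev_eq !(ei_eqE hz) !(ce0 z).
  by rewrite !negb_and.
move: d crossP; rewrite /ev_det /= !(ceD, ceN, ceM hz).
move: (ce a.1.1) (ce a.1.2) (ce a.2) (ce b.1.1) (ce b.1.2) (ce b.2) ha hb.
move: (ce c.1.1) (ce c.1.2) (ce c.2).
move=> c0 c1 c2 a0 a1 a2 b0 b1 b2 ha hb d.
have cramer x y1 y2 t : x * (c0 * v0 + c1 * v1 + c2 * v2) =
    ((a1 * b2 - a2 * b1) * c0 + (a2 * b0 - a0 * b2) * c1 + (a0 * b1 - a1 * b0) * c2) * t
    - y1 * (a0 * v0 + a1 * v1 + a2 * v2) - y2 * (b0 * v0 + b1 * v1 + b2 * v2) ->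
    x != 0 -> c0 * v0 + c1 * v1 + c2 * v2 == 0.
  rewrite ha hb !mulr0 !subr0 => + x0.
  have -> : (a1 * b2 - a2 * b1) * c0 + (a2 * b0 - a0 * b2) * c1 + (a0 * b1 - a1 * b0) * c2 = 0.
    by rewrite -d; ring.
  by rewrite mul0r => /eqP; rewrite mulf_eq0 (negPf x0).
case/or3P; [apply: (cramer _ (b1 * c2 - b2 * c1) (c1 * a2 - c2 * a1) v0)
  | apply: (cramer _ (b2 * c0 - b0 * c2) (c2 * a0 - c0 * a2) v1)
  | apply: (cramer _ (b0 * c1 - b1 * c0) (c0 * a1 - c1 * a0) v2)]; ring.
Qed.

End Mirrors.

(** * Products of two mirror generators *)

(** A tuple [N a0 a1 a2 b0 b1 b2] stands for the element
    [a0 + a1 Z + a2 Z^2 + (b0 + b1 Z + b2 Z^2) n] of the group algebra of a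
    group of order 6 acting on an element of a module, [N] being its
    annihilator. *)
Lemma annihilator_full (A : comNzRingType) (N : A -> A -> A -> A -> A -> A -> Prop)
    (u v t d : A) :
  (forall a0 a1 a2 b0 b1 b2 c0 c1 c2 d0 d1 d2,
     N a0 a1 a2 b0 b1 b2 -> N c0 c1 c2 d0 d1 d2 ->
     N (a0 + c0) (a1 + c1) (a2 + c2) (b0 + d0) (b1 + d1) (b2 + d2)) ->
  (forall c a0 a1 a2 b0 b1 b2, N a0 a1 a2 b0 b1 b2 ->
     N (c * a0) (c * a1) (c * a2) (c * b0) (c * b1) (c * b2)) ->
  (forall a0 a1 a2 b0 b1 b2, N a0 a1 a2 b0 b1 b2 -> N a2 a0 a1 b2 b0 b1) ->
  (forall a0 a1 a2 b0 b1 b2, N a0 a1 a2 b0 b1 b2 -> N b0 b1 b2 a0 a1 a2) ->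
  (exists u', u' * u = 1) -> (exists v', v' * v = 1) ->
  (exists t', t' * t = 1) -> (exists d', d' * d = 1) ->
  N (u * d) 0 0 (v * t) (v * v) (u * v) ->
  N (v * d) 0 0 (u * t) (u * v) (u * u) ->
  N (t * d) (u * v) (u * v) 0 (v * v) (u * u) ->
  N (u * d) (u * t) (v * v) 0 (v * t) (u * v) ->
  N (v * d) (u * u) (v * t) 0 (u * v) (u * t) ->
  N 1 0 0 0 0 0.
Proof.
move=> ND0 NM0 NZ0 Nn0 [u' uu] [v' vv] [t' tt] [d' dd] e1 e2 d1 d2 d3.
have ND a0 a1 a2 b0 b1 b2 c0 c1 c2 f0 f1 f2 (h : N a0 a1 a2 b0 b1 b2)
  (k : N c0 c1 c2 f0 f1 f2) := ND0 _ _ _ _ _ _ _ _ _ _ _ _ h k.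
have NM c a0 a1 a2 b0 b1 b2 (h : N a0 a1 a2 b0 b1 b2) := NM0 c _ _ _ _ _ _ h.
have NZ a0 a1 a2 b0 b1 b2 (h : N a0 a1 a2 b0 b1 b2) := NZ0 _ _ _ _ _ _ h.
have Nn a0 a1 a2 b0 b1 b2 (h : N a0 a1 a2 b0 b1 b2) := Nn0 _ _ _ _ _ _ h.
have Neq a0 a1 a2 b0 b1 b2 c0 c1 c2 f0 f1 f2 : N a0 a1 a2 b0 b1 b2 ->
    [/\ c0 = a0, c1 = a1 & c2 = a2] -> [/\ f0 = b0, f1 = b1 & f2 = b2] ->
    N c0 c1 c2 f0 f1 f2.
  by move=> h [-> -> ->] [-> -> ->].
have Ninv c c' a0 a1 a2 b0 b1 b2 : c' * c = 1 ->
    N (c * a0) (c * a1) (c * a2) (c * b0) (c * b1) (c * b2) -> N a0 a1 a2 b0 b1 b2.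
  by move=> e /(NM c') h; apply: (Neq _ _ _ _ _ _ _ _ _ _ _ _ h); split; rewrite mulrA e mul1r.
(* In [u e1 - v e2] all terms but those in [d] cancel. *)
have s1 : N (u * u - v * v) 0 0 0 0 0.
  apply: (Ninv _ _ _ _ _ _ _ _ dd).
  by apply: (Neq _ _ _ _ _ _ _ _ _ _ _ _
    (ND _ _ _ _ _ _ _ _ _ _ _ _ (NM u _ _ _ _ _ _ e1) (NM (- v) _ _ _ _ _ _ e2))); split; ring.
have s1Z := NZ _ _ _ _ _ _ s1; have s1Z2 := NZ _ _ _ _ _ _ s1Z.
have d1' : N (t * d) (u * v) (u * v) 0 (u * u) (u * u).
  by apply: (Neq _ _ _ _ _ _ _ _ _ _ _ _
    (ND _ _ _ _ _ _ _ _ _ _ _ _ d1 (Nn _ _ _ _ _ _ s1Z))); split; ring.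
(* [u n = v], from [(u n - v) d1'] and [n^2 = 1]. *)
have s2 : N (- v) 0 0 u 0 0.
  apply: (Ninv _ _ _ _ _ _ _ _ tt); apply: (Ninv _ _ _ _ _ _ _ _ dd).
  by apply: (Neq _ _ _ _ _ _ _ _ _ _ _ _ (ND _ _ _ _ _ _ _ _ _ _ _ _
    (ND _ _ _ _ _ _ _ _ _ _ _ _ (NM u _ _ _ _ _ _ (Nn _ _ _ _ _ _ d1')) (NM (- v) _ _ _ _ _ _ d1'))
    (ND _ _ _ _ _ _ _ _ _ _ _ _ (NM (- u) _ _ _ _ _ _ s1Z)
       (NM (- u) _ _ _ _ _ _ s1Z2)))); split; ring.
have s2Z := NZ _ _ _ _ _ _ s2; have s2Z2 := NZ _ _ _ _ _ _ s2Z.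
(* [d2 - e1] no longer contains [d]; [s2] then eliminates [n], and [u] can be cancelled. [s4] treats
   [d3 - e2] in the same way. *)
have s3 : N (- t) (2 * t - v) u 0 0 0.
  apply: (Ninv _ _ _ _ _ _ _ _ uu).
  have h := ND _ _ _ _ _ _ _ _ _ _ _ _ d2 (NM (-1) _ _ _ _ _ _ e1).
  have k := ND _ _ _ _ _ _ _ _ _ _ _ _ (NM (- t) _ _ _ _ _ _ (Nn _ _ _ _ _ _ s2))
    (NM (t - v) _ _ _ _ _ _ (Nn _ _ _ _ _ _ s2Z)).
  by apply: (Neq _ _ _ _ _ _ _ _ _ _ _ _ (ND _ _ _ _ _ _ _ _ _ _ _ _ h
    (ND _ _ _ _ _ _ _ _ _ _ _ _ k s1Z2))); split; ring.
have s4 : N (- t) v (2 * t - u) 0 0 0.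
  apply: (Ninv _ _ _ _ _ _ _ _ vv).
  have h := ND _ _ _ _ _ _ _ _ _ _ _ _ d3 (NM (-1) _ _ _ _ _ _ e2).
  have k := ND _ _ _ _ _ _ _ _ _ _ _ _ (NM t _ _ _ _ _ _ s2) (NM (u - t) _ _ _ _ _ _ s2Z2).
  by apply: (Neq _ _ _ _ _ _ _ _ _ _ _ _ (ND _ _ _ _ _ _ _ _ _ _ _ _ h
    (ND _ _ _ _ _ _ _ _ _ _ _ _ k (NM (-1) _ _ _ _ _ _ s1Z)))); split; ring.
(* [s3 + s4] is [2 t (Z + Z^2 - 1)]. Adding two of its cyclic shifts will give 4. *)
have s5 : N (- 2) 2 2 0 0 0.
  apply: (Ninv _ _ _ _ _ _ _ _ tt).
  by apply: (Neq _ _ _ _ _ _ _ _ _ _ _ _ (ND _ _ _ _ _ _ _ _ _ _ _ _ s3 s4)); split; ring.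
have s5Z := NZ _ _ _ _ _ _ s5; have s5Z2 := NZ _ _ _ _ _ _ s5Z.
have s6 : N 4 0 0 0 0 0.
  by apply: (Neq _ _ _ _ _ _ _ _ _ _ _ _ (ND _ _ _ _ _ _ _ _ _ _ _ _ s5Z s5Z2)); split; ring.
(* In [d1'] the terms in [n] become [u v (Z + Z^2)] by [s2], and [2 (Z + Z^2) = 2] by [s5]. Doubling
   the result and using [s6] gives [s8]; then [t d] itself annihilates. *)
have s7 : N (t * d + 2 * (u * v)) 0 0 0 0 0.
  have h := ND _ _ _ _ _ _ _ _ _ _ _ _ (NM (- u) _ _ _ _ _ _ s2Z) (NM (- u) _ _ _ _ _ _ s2Z2).
  have k := ND _ _ _ _ _ _ _ _ _ _ _ _ d1' (NM (- (u * v)) _ _ _ _ _ _ s5).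
  by apply: (Neq _ _ _ _ _ _ _ _ _ _ _ _ (ND _ _ _ _ _ _ _ _ _ _ _ _ h k)); split; ring.
have s8 : N 2 0 0 0 0 0.
  apply: (Ninv _ _ _ _ _ _ _ _ tt); apply: (Ninv _ _ _ _ _ _ _ _ dd).
  by apply: (Neq _ _ _ _ _ _ _ _ _ _ _ _ (ND _ _ _ _ _ _ _ _ _ _ _ _
    (NM 2 _ _ _ _ _ _ s7) (NM (- (u * v)) _ _ _ _ _ _ s6))); split; ring.
apply: (Ninv _ _ _ _ _ _ _ _ tt); apply: (Ninv _ _ _ _ _ _ _ _ dd).
by apply: (Neq _ _ _ _ _ _ _ _ _ _ _ _ (ND _ _ _ _ _ _ _ _ _ _ _ _
  s7 (NM (- (u * v)) _ _ _ _ _ _ s8))); split; ring.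
Qed.

Definition wimg (l : seq nat) (x : evec) : evec := foldl (fun y n => rimg (rdat n) y) x l.
Definition wnorm (l : seq nat) : ei :=
  foldr (fun n c => ei_mul (root_norm (rdat n).1) c) (ei_root 0) l.
(** [wimg] carries the factor [wnorm], hence the cross-multiplication. *)
Definition weq (l k : seq nat) : bool :=
  all (fun i => ev_eq (ev_scale (wnorm k) (wimg l (ev_unit i)))
                      (ev_scale (wnorm l) (wimg k (ev_unit i)))) (iota 0 3).

Definition refl_from_to (j k : nat) : seq nat := [seq n <- iota 0 33 | maps n j k].

(** The preimage of mirror [k] under reflection [n]; the value 21 would mean that there is none. *)
Definition pre (n k : nat) : nat := find (fun j => maps n j k) (iota 0 21).

(** The conjugacy classes of reflections: order 3 with eigenvalue [zeta], order 3 with [zeta^2],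
    order 2. *)
Definition refl_kind (n : nat) : nat := if (n < 24)%N then nat_of_bool (odd n) else 2%N.
Definition kind_rep (n : nat) : nat := if (n < 24)%N then nat_of_bool (odd n) else 24%N.

Lemma kind_conj : all (fun n => let m := kind_rep n in
  ei_eq (rdat n).2 (rdat m).2 &&
  has (fun k => maps k (rdat m).1 (rdat n).1) (iota 0 33)) (iota 0 33).
Proof. by vm_compute. Qed.

Lemma mirror_index : all (fun i => has (fun n => (rdat n).1 == i) (iota 0 33)) (iota 0 21).
Proof. by vm_compute. Qed.

Local Open Scope nat_scope.
(** Letters 0, 1, 2 and 3 stand for the parameters of the three classes of
    reflections and for [delta]. Given [x = e_p e_q = e_q e_p] with [e_k e_q = 0],
    the relation [e_m (e_k x) = 0] is a sum of products of letters times a word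
    applied to [x]; [terms] lists the letters and words. *)
Definition terms (p q k m : nat) : seq (seq nat * seq nat) :=
  flatten [seq if pre s m == q then [:: ([:: refl_kind s; 3], [:: s])] else
      [seq ([:: refl_kind s; refl_kind t], [:: s; t]) | t <- refl_from_to q (pre s m)]
    | s <- refl_from_to p k].

(** [zeta] and [-1] as products of reflections. *)
Definition zeta_word : seq nat := [:: 0; 2; 4].
Definition opp_word : seq nat := [:: 0; 6; 22; 30].

(** Writing [k = r + 3 s] with [r < 3], this is [zeta^r (-1)^s] for [k < 6]. *)
Definition central_word (k : nat) : seq nat :=
  flatten (nseq (k %% 3) zeta_word) ++ flatten (nseq (k %/ 3) opp_word).

(** Words which fix both [e_12] and [e_2]. *)
Definition fixing_words : seq (seq nat) :=
  [:: [::]; [:: 4]; [:: 4; 4]; [:: 24]; [:: 24; 4]; [:: 24; 4; 4]].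

(** The central part of [l] relative to [s0], modulo words fixing the base element [e_12 e_2]; the
    value 6 means failure. *)
Definition nf (s0 : nat) (l : seq nat) : nat :=
  find (fun k => has (fun t => weq l (s0 :: central_word k ++ t)) fixing_words) (iota 0 6).

Local Close Scope nat_scope.

(** This empties the sum in B5 for mirrors of different orders. *)
Lemma refl_from_to_distinct_kind : all (fun i => all (fun j =>
  ((i < 12) != (j < 12))%N ==> (refl_from_to i j == [::])) (iota 0 21)) (iota 0 21).
Proof. by vm_compute. Qed.

(** Conditionals instead of boolean connectives, whose arguments [vm_compute]
    evaluates eagerly. *)
Definition reach_check (a b : nat) : bool :=
  if [|| nontransverse a b, (12 <= b)%N | (a < 12)%N] then true else
  has (fun n => let a' := pre n a in let b' := pre n b in
    if maps n a' a && maps n b' b then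
      has (fun m => if maps m 12 a' then maps m 2 b' else false) (iota 0 33)
    else false) (iota 0 33).

(** Two reflections suffice to reach each remaining pair from the base pair of mirrors 12 and 2. *)
Lemma transverse_reach : all (fun a => all (reach_check a) (iota 0 21)) (iota 0 21).
Proof. by vm_compute. Qed.

(** * Vanishing of [e_i e_j] for mirrors of different orders *)

Section Relations.
Variables (C : numClosedFieldType) (z : C).
Hypothesis hz : z ^+ 2 + z + 1 = 0.
Variable W : set 'M[C]_3.
Hypothesis W1 : W 1%:M.
Hypothesis WM : forall g h, W g -> W h -> W (g *m h).
Hypothesis WV : forall g, W g -> W (invmx g).
Local Notation rmat := (refl_mx z).
Local Notation hform := (mirror z).
Local Notation cv := (cv z).
Local Notation ce := (ce z).
Hypothesis Wgen : forall n, W (rmat n).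
Hypothesis Wind : forall P : set 'M[C]_3, P 1%:M -> (forall n, P (rmat n)) ->
  (forall g h, W g -> W h -> P g -> P h -> P (g *m h)) ->
  (forall g, W g -> P g -> P (invmx g)) -> forall g, W g -> P g.
Local Notation refls := (@reflections C 3 W).

Let WU g : W g -> g \in unitmx.
Proof. exact: (W_unit hz Wind). Qed.

Fixpoint wmat (l : seq nat) : 'M[C]_3 :=
  if l is n :: l' then rmat n *m wmat l' else 1%:M.

Lemma wnorm_neq0 l : ce (wnorm l) != 0.
Proof.
elim: l => [|n l IH]; first by rewrite /= (ce_root hz (k := 0)) // expr0 oner_neq0.
by rewrite /= (ceM hz) mulf_neq0 // (root_norm_neq0 hz).
Qed.

Lemma cv_wimg l x : cv (wimg l x) = ce (wnorm l) *: (cv x *m wmat l).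
Proof.
elim: l x => [|n l IH] x; first by rewrite /= (ce_root hz (k := 0)) // expr0 scale1r mulmx1.
rewrite /= IH (cv_rimg hz) (ceM hz) -scalemxAl scalerA mulmxA [ce _ * _]mulrC.
by [].
Qed.

Lemma weqP l k : weq l k -> wmat l = wmat k.
Proof.
move=> /allP h; have e (i : nat) : (i < 3)%N -> cv (ev_unit i) *m wmat l = cv (ev_unit i) *m wmat k.
  move=> hi; have := h i; rewrite mem_iota hi => /(_ isT).
  rewrite (ev_eqE hz) !(cvZ hz) !cv_wimg !scalerA [ce (wnorm k) * _]mulrC => /eqP.
  by apply: scalerI; rewrite mulf_neq0 ?wnorm_neq0.
apply: (basis_ext hz) => v; rewrite !inE => hv.
have [c] : exists c : nat -> ei, ev_eq v (ev_add (ev_add (ev_scale (c 0) (ev_unit 0))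
   (ev_scale (c 1) (ev_unit 1))) (ev_scale (c 2) (ev_unit 2))).
  exists (ev_coord v); case/or3P: hv => /eqP ->; vm_compute => //.
rewrite (ev_eqE hz) !(cvD z) !(cvZ hz) => /eqP ->.
by rewrite !mulmxDl -!scalemxAl !e.
Qed.

Definition rw_el n : W := SigSub (mem_set (Wgen n)).

Lemma rf_subproof n : reflections (rw_el n).
Proof. exact: (rmat_reflection hz). Qed.

Definition rf n : refls := SigSub (mem_set (rf_subproof n)).

Lemma hy_subproof i : hyperplanes W (hform i).
Proof.
have [n e] : exists n, mroot (rdat n).1 = mroot i.
  have [hi|hi] := ltnP i 21.
    have /hasP[n _ /eqP e] : has (fun n => (rdat n).1 == i) (iota 0 33).
      by apply: (allP mirror_index); rewrite mem_iota.
    by exists n; rewrite e.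
  by exists 0; rewrite [RHS]nth_default.
by exists (rw_el n); [exact: rf_subproof|rewrite /= (ker1_rmat hz) /mirror e].
Qed.

Definition hy i : hyperplanes W := SigSub (mem_set (hy_subproof i)).

Lemma refl_rf (s : refls) : exists2 n, (n < 33)%N & s = rf n.
Proof.
have [n hn e] := refl_class hz Wind (valW (val s)) (set_valP s).
by exists n => //; apply/val_inj/val_inj.
Qed.

Lemma hyp_hy (H : hyperplanes W) : exists2 i, (i < 21)%N & H = hy i.
Proof.
have [r rr e] := set_valP H.
have [n hn en] := refl_class hz Wind (valW r) rr.
exists (rdat n).1; first exact: rdat_lt.
by apply: val_inj; rewrite /= e en (ker1_rmat hz).
Qed.

Lemma hy_inj i j : (i < 21)%N -> (j < 21)%N -> hy i = hy j -> i = j.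
Proof. by move=> hi hj /(congr1 val) /= e; exact: (hform_inj hz hi hj e). Qed.

Lemma rf_inj n m : (n < 33)%N -> (m < 33)%N -> rf n = rf m -> n = m.
Proof. by move=> hn hm /(congr1 (fun s => val (val s))); exact: (rmat_inj hz hn hm). Qed.

Lemma nontransverseP i j : (i < 21)%N -> (j < 21)%N -> nontransverse i j ->
  hy i <> hy j /\ ~ transverse (hy i) (hy j).
Proof.
move=> hi hj /andP[ij /hasP[k]]; rewrite mem_iota => /andP[_ hk] /and3P[ki kj d].
split=> [/(hy_inj hi hj)|[_ tr]]; first exact/eqP.
have ab : ev_par (mroot i) (mroot j) = false.
  by apply/negbTE; have := all2_iota roots_indep hi hj; rewrite (negPf ij).
have [/(hy_inj hk hi)|/(hy_inj hk hj)] := tr (hy k) (det_fker hz ab d); exact/eqP.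
Qed.

Local Notation r_ n := (br_w (rw_el n)).
Local Notation e_ i := (br_e (hy i)).

Lemma br_w_mirror n j k : maps n j k -> r_ n * e_ j = e_ k * r_ n.
Proof.
move=> /(mapsP hz) h; rewrite (br_we WU W1 WM WV).
by congr (br_e _ * _); exact: val_inj.
Qed.

Lemma r_fix n i : (rdat n).1 = i -> r_ n * e_ i = e_ i.
Proof. by move=> e; apply: br_fix; rewrite /= (ker1_rmat hz) e subvv. Qed.

(** A reflection carrying one mirror to the other conjugates the two reflections, since their
    eigenvalues agree. *)
Lemma mu_kind n : (n < 33)%N -> mu (rf n) = mu (rf (kind_rep n)).
Proof.
move=> hn; have /allP/(_ n) := kind_conj; rewrite mem_iota => /(_ hn).
set m := kind_rep n; case/andP; rewrite (ei_eqE hz) => /eqP ev /hasP[k _ /(mapsP hz) h].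
apply/esym/cls_rel/coef_conj; exists (rw_el k).
pose a := cv (mroot (rdat m).1); pose b := cv (mroot (rdat n).1).
rewrite -[RHS]/(rw b (ce (rdat n).2)) ev -[LHS]/(rmat k *m rw a (ce (rdat m).2) *m invmx (rmat k)).
have uk := rmat_unitary hz k; have uu := rmat_unit hz k.
have [c eb] : exists c, b *m rmat k = c *: a.
  have e : fker b = hact (rmat k) (fker a) by exact/esym/h.
  by apply: fker_eqP; rewrite -[RHS](hactK _ uu) hact_fker // e hactK.
have c0 : c != 0.
  apply: contraNneq (cv_root_neq0 hz (rdat n).1) => c0.
  by move: eb; rewrite c0 scale0r => eb; rewrite -/b -[b](mulmxK uu) eb mul0mx.
rewrite -(rw_scale a _ c0) -eb rw_mul_unitary // !mulmxA mulmxV // mul1mx.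
by rewrite mulmxK.
Qed.

Lemma ee_sum_nt i j : hy i <> hy j -> ~ transverse (hy i) (hy j) ->
  e_ i * e_ j = \sum_(n <- refl_from_to j i) mu (rf n) *: (r_ n * e_ j).
Proof.
move=> ne nt; rewrite (@br_eeN _ _ _ _ _ (map rf (refl_from_to j i))) //.
- by rewrite big_map.
- rewrite map_inj_in_uniq ?filter_uniq ?iota_uniq // => n m.
  by rewrite !mem_filter !mem_iota => /andP[_ /andP[_ hn]] /andP[_ /andP[_ hm]]; exact: rf_inj.
- move=> s; split=> [/mapP[n]|].
    by rewrite mem_filter => /andP[/(mapsP hz) h _] ->.
  have [n hn ->] := refl_rf s => /(mapsP hz) h.
  by apply: map_f; rewrite mem_filter h mem_iota.
Qed.

Lemma ee_sum i j : (i < 21)%N -> (j < 21)%N -> nontransverse i j ->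
  e_ i * e_ j = \sum_(n <- refl_from_to j i) mu (rf n) *: (r_ n * e_ j).
Proof. by move=> hi hj ij; have [ne nt] := nontransverseP hi hj ij; exact: ee_sum_nt. Qed.

Fixpoint welt (l : seq nat) : W :=
  if l is n :: l' then mulW WM (rw_el n) (welt l') else oneW W1.

Lemma val_welt l : val (welt l) = wmat l.
Proof. by elim: l => //= n l ->. Qed.

Definition wd (l : seq nat) : Br W := br_w (welt l).

Lemma wd_cons n l : wd (n :: l) = r_ n * wd l.
Proof. exact: br_wM. Qed.

Lemma wd0 : wd [::] = 1.
Proof. exact: br_w1. Qed.

Lemma wd_cat l k : wd (l ++ k) = wd l * wd k.
Proof. by elim: l => [|n l IH]; rewrite ?wd0 ?mul1r //= !wd_cons IH mulrA. Qed.

Lemma wd_eq l k : weq l k -> wd l = wd k.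
Proof. by move=> /weqP e; congr br_w; apply: val_inj; rewrite !val_welt. Qed.

(** The sum is [e_k e_p e_q] by B5, and [e_k e_q e_p = 0] because no reflection maps [q] to [k]. *)
Lemma zero_rel p q k : (p < 21)%N -> (q < 21)%N -> (k < 21)%N ->
  e_ p * e_ q = e_ q * e_ p -> nontransverse k q -> refl_from_to q k = [::] ->
  nontransverse k p ->
  \sum_(s <- refl_from_to p k) mu (rf s) *: (r_ s * (e_ p * e_ q)) = 0.
Proof.
move=> hp hq hk pq kq kq0 kp.
transitivity (e_ k * e_ p * e_ q).
  rewrite (ee_sum hk hp kp) mulr_suml; apply: eq_bigr => s _.
  by rewrite -scalerAl mulrA.
by rewrite -mulrA pq mulrA (ee_sum hk hq kq) kq0 big_nil mul0r.
Qed.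

Local Notation A := (coef W).

Definition sym (c : nat) : A :=
  match c with
  | 0%N => mu (rf 0) | 1%N => mu (rf 1) | 2%N => mu (rf 24) | _ => delta W
  end.

Definition sym_prod (l : seq nat) : A := foldr (fun c a => sym c * a) 1 l.

Lemma mu_sym n : (n < 33)%N -> mu (rf n) = sym (refl_kind n).
Proof.
move=> hn; rewrite (mu_kind hn) /kind_rep /refl_kind.
by case: ifP => // _; case: odd.
Qed.

Lemma mem_refl_from_to n j k : n \in refl_from_to j k = (maps n j k && (n < 33)%N).
Proof. by rewrite mem_filter mem_iota. Qed.

Lemma terms_rel p q k m : (p < 21)%N -> (q < 21)%N -> (k < 21)%N ->
  e_ p * e_ q = e_ q * e_ p -> nontransverse k q -> refl_from_to q k = [::] ->
  nontransverse k p ->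
  all (fun s => (pre s m < 21)%N && ((pre s m == q) || nontransverse (pre s m) q))
    (refl_from_to p k) ->
  \sum_(a <- terms p q k m) sym_prod a.1 *: (wd a.2 * (e_ p * e_ q)) = 0.
Proof.
move=> hp hq hk pq kq kq0 kp /allP hm.
transitivity (e_ m * \sum_(s <- refl_from_to p k) mu (rf s) *: (r_ s * (e_ p * e_ q)));
  last by rewrite zero_rel // mulr0.
rewrite /terms big_flatten big_map mulr_sumr.
rewrite big_seq [RHS]big_seq; apply: eq_bigr => s sl; have /andP[hs hsq] := hm s sl.
have /andP[_ s33] : maps s p k && (s < 33)%N by rewrite -mem_refl_from_to.
have ms : maps s (pre s m) m.
  have h : has (fun j => maps s j m) (iota 0 21) by rewrite has_find size_iota.
  by have := nth_find 0%N h; rewrite nth_iota.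
(* Moving [e_m] past [s] turns it into [e_(pre s m)], which is placed next to [e_q]: B1 applies if
   the two mirrors coincide, B5 otherwise. *)
rewrite (mu_sym s33) -scalerAr [e_ m * _]mulrA -(br_w_mirror ms) -mulrA pq.
case: ifP hsq => [/eqP -> _|_ /= nt].
  rewrite big_seq1 /= wd_cons wd0 mulr1 [e_ q * (_ * _)]mulrA br_ee -scalerAl -scalerAr.
  by rewrite scalerA mulr1.
rewrite big_map [e_ (pre s m) * (_ * _)]mulrA (ee_sum hs hq nt) mulr_suml mulr_sumr scaler_sumr.
rewrite big_seq [RHS]big_seq; apply: eq_bigr => t; rewrite mem_refl_from_to => /andP[_ t33].
rewrite /= !wd_cons wd0 !mulr1 (mu_sym t33) -scalerAl -scalerAr scalerA.
by rewrite -!mulrA.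
Qed.

Section Base.
Local Notation x := (e_ 12%N * e_ 2%N).
Hypothesis xC : e_ 12%N * e_ 2%N = e_ 2%N * e_ 12%N.

Lemma wd_fix t : t \in fixing_words -> wd t * x = x.
Proof.
have f12 : r_ 24%N * x = x by rewrite mulrA r_fix.
have f2 : r_ 4%N * x = x by rewrite xC mulrA r_fix.
rewrite !inE => /or4P[|||/or3P[]] /eqP ->;
  by rewrite ?wd_cons wd0 ?mulr1 -?mulrA ?mul1r ?f2 ?f2 ?f12.
Qed.

Lemma wd_nf s0 l : (nf s0 l < 6)%N ->
  wd l * x = r_ s0 * (wd (central_word (nf s0 l)) * x).
Proof.
set k := nf s0 l => hk.
have h : has (fun k => has (fun t => weq l (s0 :: central_word k ++ t)) fixing_words) (iota 0 6).
  by rewrite has_find size_iota.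
have /hasP[t ht e] := nth_find 0%N h.
move: e; rewrite -/(nf s0 l) -/k nth_iota // add0n => /wd_eq ->.
by rewrite wd_cons wd_cat -!mulrA wd_fix.
Qed.

(** Every word starts, up to fixing words, with the invertible factor [s0], which is cancelled. *)
Lemma nf_rel p q k m s0 : (p < 21)%N -> (q < 21)%N -> (k < 21)%N ->
  e_ p * e_ q = e_ q * e_ p -> nontransverse k q -> refl_from_to q k = [::] ->
  nontransverse k p ->
  all (fun s => (pre s m < 21)%N && ((pre s m == q) || nontransverse (pre s m) q))
    (refl_from_to p k) ->
  e_ p * e_ q = x ->
  all (fun a => nf s0 a.2 < 6)%N (terms p q k m) ->
  \sum_(a <- [seq (sym_prod a.1, nf s0 a.2) | a <- terms p q k m])
     a.1 *: (wd (central_word a.2) * x) = 0.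
Proof.
move=> hp hq hk pq kq kq0 kp hm pqx /allP hnf.
have := terms_rel hp hq hk pq kq kq0 kp hm; rewrite big_map pqx big_seq.
under eq_bigr => a ha do rewrite (wd_nf (hnf a ha)) scalerAr.
rewrite -big_seq -mulr_sumr => /(congr1 (fun y => br_w (invW WV (rw_el s0)) * y)).
by rewrite mulr0 mulrA (br_wV WU W1 WM WV) mul1r.
Qed.

Definition coef_at (l : seq (A * nat)) (k : nat) : A :=
  foldr (fun a c => if a.2 == k then a.1 + c else c) 0 l.

Lemma sum_coef_at (l : seq (A * nat)) (X : nat -> Br W) (n : nat) :
  all (fun a => a.2 < n)%N l ->
  \sum_(a <- l) a.1 *: X a.2 = \sum_(k < n) coef_at l k *: X k.
Proof.
elim: l => [_|a l IH /= /andP[ha /IH e]].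
  by rewrite big_nil big1 // => k _; rewrite scale0r.
rewrite big_cons e (bigD1 (Ordinal ha)) //= [RHS](bigD1 (Ordinal ha)) //= eqxx scalerDl addrA.
congr (_ + _); apply: eq_bigr => k kn; case: eqP => // ak.
by case/eqP: kn; apply: val_inj.
Qed.

Definition annihilator (a0 a1 a2 b0 b1 b2 : A) : Prop :=
  \sum_(k < 6) nth 0 [:: a0; a1; a2; b0; b1; b2] k *: (wd (central_word k) * x) = 0.

Lemma annihilator_coef (l : seq (A * nat)) :
  all (fun a => a.2 < 6)%N l ->
  \sum_(a <- l) a.1 *: (wd (central_word a.2) * x) = 0 ->
  annihilator (coef_at l 0) (coef_at l 1) (coef_at l 2)
              (coef_at l 3) (coef_at l 4) (coef_at l 5).
Proof.
move=> hl; rewrite (@sum_coef_at l (fun k => wd (central_word k) * x) 6) // => e.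
by apply: (etrans _ e); apply: eq_bigr => -[[|[|[|[|[|[|]]]]]] //= i] _.
Qed.

Lemma annihilatorD a0 a1 a2 b0 b1 b2 c0 c1 c2 d0 d1 d2 :
  annihilator a0 a1 a2 b0 b1 b2 -> annihilator c0 c1 c2 d0 d1 d2 ->
  annihilator (a0 + c0) (a1 + c1) (a2 + c2) (b0 + d0) (b1 + d1) (b2 + d2).
Proof.
move=> h1 h2; have := congr2 +%R h1 h2; rewrite addr0 -big_split /= => e.
apply: (etrans _ e); apply: eq_bigr => -[k hk] _; rewrite -scalerDl; congr (_ *: _).
by case: k hk => [|[|[|[|[|[|]]]]]].
Qed.

Lemma annihilatorM c a0 a1 a2 b0 b1 b2 : annihilator a0 a1 a2 b0 b1 b2 ->
  annihilator (c * a0) (c * a1) (c * a2) (c * b0) (c * b1) (c * b2).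
Proof.
move=> h1; have := congr1 ( *:%R c) h1; rewrite scaler0 scaler_sumr => e.
apply: (etrans _ e); apply: eq_bigr => -[k hk] _; rewrite scalerA; congr (_ *: _).
by case: k hk => [|[|[|[|[|[|]]]]]].
Qed.

(** Multiplication by the word [l] moves central element [k] to [f k]; it is used for [zeta] and for
    [-1]. *)
Lemma annihilator_shift (l : seq nat) (f : nat -> nat) a0 a1 a2 b0 b1 b2 :
  all (fun k => (f k < 6) && weq (l ++ central_word k) (central_word (f k)))%N (iota 0 6) ->
  let s := [:: a0; a1; a2; b0; b1; b2] in
  let c := [seq (nth 0 s k, f k) | k <- iota 0 6] in
  annihilator a0 a1 a2 b0 b1 b2 ->
  annihilator (coef_at c 0) (coef_at c 1) (coef_at c 2)
              (coef_at c 3) (coef_at c 4) (coef_at c 5).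
Proof.
move=> /allP h s c h1; apply: annihilator_coef.
  by apply/allP => _ /mapP[k /h /andP[hk _] ->].
rewrite big_map big_seq; have := congr1 ( *%R (wd l)) h1; rewrite mulr0 mulr_sumr => e0.
apply: (etrans _ e0).
rewrite -(big_mkord xpredT (fun k => wd l * (nth 0 s k *: (wd (central_word k) * x)))).
rewrite /index_iota subn0 [RHS]big_seq; apply: eq_bigr => k /h /andP[_ /wd_eq e].
by rewrite -scalerAr -e wd_cat -mulrA.
Qed.

Lemma annihilatorZ a0 a1 a2 b0 b1 b2 :
  annihilator a0 a1 a2 b0 b1 b2 -> annihilator a2 a0 a1 b2 b0 b1.
Proof.
move=> h; have := @annihilator_shift zeta_word (fun k => (k %/ 3) * 3 + (k.+1 %% 3))%N
  a0 a1 a2 b0 b1 b2 isT h.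
by rewrite /coef_at /= !addr0.
Qed.

Lemma annihilatorN a0 a1 a2 b0 b1 b2 :
  annihilator a0 a1 a2 b0 b1 b2 -> annihilator b0 b1 b2 a0 a1 a2.
Proof.
move=> h; have := @annihilator_shift opp_word (fun k => (k + 3) %% 6)%N
  a0 a1 a2 b0 b1 b2 isT h.
by rewrite /coef_at /= !addr0.
Qed.

Lemma annihilator_terms p q k m s0 L : (p < 21)%N -> (q < 21)%N -> (k < 21)%N ->
  e_ p * e_ q = e_ q * e_ p -> nontransverse k q -> refl_from_to q k = [::] ->
  nontransverse k p ->
  all (fun s => (pre s m < 21)%N && ((pre s m == q) || nontransverse (pre s m) q))
    (refl_from_to p k) ->
  e_ p * e_ q = x ->
  [seq (a.1, nf s0 a.2) | a <- terms p q k m] = L ->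
  all (fun a => a.2 < 6)%N L ->
  let l := [seq (sym_prod a.1, a.2) | a <- L] in
  annihilator (coef_at l 0) (coef_at l 1) (coef_at l 2)
              (coef_at l 3) (coef_at l 4) (coef_at l 5).
Proof.
move=> hp hq hk pq kq kq0 kp hm pqx eL hL l; apply: annihilator_coef.
  by rewrite all_map.
rewrite /l -eL -map_comp; apply: nf_rel => //.
by move: hL; rewrite -eL all_map.
Qed.

Lemma mu_unit s : exists m, m * mu s = 1 :> A.
Proof.
exists (cls _ (Gen (MuInv s))); rewrite mulrC -clsM.
by apply/cls_rel/coef_mu.
Qed.

Lemma delta_unit : exists m, m * delta W = 1 :> A.
Proof.
exists (cls _ (Gen (@DeltaInv _ _ W))); rewrite mulrC -clsM.
by apply/cls_rel/coef_delta.
Qed.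

Lemma ee_base : x = 0.
Proof.
have Neq a0 a1 a2 b0 b1 b2 c0 c1 c2 f0 f1 f2 : annihilator a0 a1 a2 b0 b1 b2 ->
    [/\ a0 = c0, a1 = c1 & a2 = c2] -> [/\ b0 = f0, b1 = f1 & b2 = f2] ->
    annihilator c0 c1 c2 f0 f1 f2.
  by move=> h [<- <- <-] [<- <- <-].
have : annihilator 1 0 0 0 0 0.
  apply: (@annihilator_full _ _ (mu (rf 0)) (mu (rf 1)) (mu (rf 24)) (delta W)
    annihilatorD annihilatorM annihilatorZ annihilatorN
    (mu_unit _) (mu_unit _) (mu_unit _) delta_unit).
  (* In all five relations [s0] is the reflection of the [delta] term, with [s0 p = k] and
     [s0 q = m], so that this term has central part 1. The first two take [p = 2], [q = 12], the
     others exchange them. *)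
  - have r0 : refl_from_to 12 6 = [::] by vm_compute.
    have n1 : nontransverse 6 12 by vm_compute.
    have n2 : nontransverse 6 2 by vm_compute.
    have a0 : all (fun s => (pre s 15 < 21)%N &&
        ((pre s 15 == 12) || nontransverse (pre s 15) 12)) (refl_from_to 2 6).
      by vm_compute.
    have t0 : [seq (a.1, nf 16 a.2) | a <- terms 2 12 6 15] =
      [:: ([:: 1; 1], 4); ([:: 1; 0], 5); ([:: 1; 2], 3); ([:: 0; 3], 0)]%N.
      by vm_compute.
    have := annihilator_terms (p := 2) (q := 12) (k := 6) isT isT isT
      (esym xC) n1 r0 n2 a0 (esym xC) t0 isT.
    by rewrite /coef_at /= => h; apply: (Neq _ _ _ _ _ _ _ _ _ _ _ _ h); split; ring.
  - have r0 : refl_from_to 12 6 = [::] by vm_compute.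
    have n1 : nontransverse 6 12 by vm_compute.
    have n2 : nontransverse 6 2 by vm_compute.
    have a0 : all (fun s => (pre s 20 < 21)%N &&
        ((pre s 20 == 12) || nontransverse (pre s 20) 12)) (refl_from_to 2 6).
      by vm_compute.
    have t0 : [seq (a.1, nf 15 a.2) | a <- terms 2 12 6 20] =
      [:: ([:: 1; 3], 0); ([:: 0; 1], 4); ([:: 0; 0], 5); ([:: 0; 2], 3)]%N.
      by vm_compute.
    have := annihilator_terms (p := 2) (q := 12) (k := 6) isT isT isT
      (esym xC) n1 r0 n2 a0 (esym xC) t0 isT.
    by rewrite /coef_at /= => h; apply: (Neq _ _ _ _ _ _ _ _ _ _ _ _ h); split; ring.
  - have r0 : refl_from_to 2 15 = [::] by vm_compute.
    have n1 : nontransverse 15 2 by vm_compute.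
    have n2 : nontransverse 15 12 by vm_compute.
    have a0 : all (fun s => (pre s 1 < 21)%N &&
        ((pre s 1 == 2) || nontransverse (pre s 1) 2)) (refl_from_to 12 15).
      by vm_compute.
    have t0 : [seq (a.1, nf 30 a.2) | a <- terms 12 2 15 1] =
      [:: ([:: 0; 1], 2); ([:: 0; 0], 5); ([:: 1; 0], 1); ([:: 1; 1], 4); ([:: 2; 3], 0)]%N.
      by vm_compute.
    have := annihilator_terms (p := 12) (q := 2) (k := 15) isT isT isT xC n1 r0 n2 a0 erefl t0 isT.
    by rewrite /coef_at /= => h; apply: (Neq _ _ _ _ _ _ _ _ _ _ _ _ h); split; ring.
  - have r0 : refl_from_to 2 15 = [::] by vm_compute.
    have n1 : nontransverse 15 2 by vm_compute.
    have n2 : nontransverse 15 12 by vm_compute.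
    have a0 : all (fun s => (pre s 6 < 21)%N &&
        ((pre s 6 == 2) || nontransverse (pre s 6) 2)) (refl_from_to 12 15).
      by vm_compute.
    have t0 : [seq (a.1, nf 16 a.2) | a <- terms 12 2 15 6] =
      [:: ([:: 0; 3], 0); ([:: 1; 1], 2); ([:: 1; 0], 5); ([:: 2; 0], 1); ([:: 2; 1], 4)]%N.
      by vm_compute.
    have := annihilator_terms (p := 12) (q := 2) (k := 15) isT isT isT xC n1 r0 n2 a0 erefl t0 isT.
    by rewrite /coef_at /= => h; apply: (Neq _ _ _ _ _ _ _ _ _ _ _ _ h); split; ring.
  - have r0 : refl_from_to 2 15 = [::] by vm_compute.
    have n1 : nontransverse 15 2 by vm_compute.
    have n2 : nontransverse 15 12 by vm_compute.
    have a0 : all (fun s => (pre s 9 < 21)%N &&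
        ((pre s 9 == 2) || nontransverse (pre s 9) 2)) (refl_from_to 12 15).
      by vm_compute.
    have t0 : [seq (a.1, nf 21 a.2) | a <- terms 12 2 15 9] =
      [:: ([:: 0; 0], 1); ([:: 0; 1], 4); ([:: 1; 3], 0); ([:: 2; 1], 2); ([:: 2; 0], 5)]%N.
      by vm_compute.
    have := annihilator_terms (p := 12) (q := 2) (k := 15) isT isT isT xC n1 r0 n2 a0 erefl t0 isT.
    by rewrite /coef_at /= => h; apply: (Neq _ _ _ _ _ _ _ _ _ _ _ _ h); split; ring.
rewrite /annihilator !big_ord_recl big_ord0 /= !scale0r !addr0 scale1r.
by rewrite -[central_word 0]/([::]) wd0 mul1r.
Qed.

End Base.

Lemma ee_transfer n i j i' j' : maps n i' i -> maps n j' j ->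
  e_ i' * e_ j' = 0 -> e_ i * e_ j = 0.
Proof.
move=> ni nj h; rewrite -[LHS]mulr1 -(br_wVr WU W1 WM WV (rw_el n)) mulrA.
rewrite -[e_ i * e_ j * _]mulrA -(br_w_mirror nj) mulrA -(br_w_mirror ni).
by rewrite -[r_ n * _ * _]mulrA h mulr0 mul0r.
Qed.

Lemma ee_distinct_kind i j : (i < 21)%N -> (j < 21)%N -> (i < 12)%N != (j < 12)%N ->
  ~ transverse (hy i) (hy j) -> e_ i * e_ j = 0.
Proof.
move=> hi hj k nt; rewrite ee_sum_nt //.
  have := all2_iota refl_from_to_distinct_kind hj hi; rewrite eq_sym k implyTb.
  by case: refl_from_to => // _; rewrite big_nil.
by move=> /(hy_inj hi hj) ij; rewrite ij eqxx in k.
Qed.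

Lemma ee_zero i j : (i < 21)%N -> (j < 21)%N -> (i < 12)%N != (j < 12)%N ->
  e_ i * e_ j = 0.
Proof.
suff main a b : (a < 21)%N -> (b < 12)%N -> (12 <= a)%N -> e_ a * e_ b = 0.
  move=> hi hj k; have [nt|/(ee_distinct_kind hi hj k)//] := pselect (transverse (hy i) (hy j)).
  have [j12|j12] := ltnP j 12; first by apply: main => //; move: k; rewrite j12; case: ltnP.
  rewrite (br_comm nt); apply: main => //.
  by move: k; rewrite ltnNge [(j < _)%N]ltnNge j12; case: leqP.
move=> ha hb a12; have hb' : (b < 21)%N by exact: leq_trans hb _.
have k : (a < 12)%N != (b < 12)%N by rewrite hb ltnNge a12.
have [nt|nt] := boolP (nontransverse a b).
  by apply: ee_distinct_kind => //; case: (nontransverseP ha hb' nt).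
(* If the base pair were not transverse, B5 would already give zero, so its transversality need not
   be decided. *)
have base : e_ 12%N * e_ 2%N = 0.
  have [tr|tr] := pselect (transverse (hy 12) (hy 2)); last exact: ee_distinct_kind.
  exact/ee_base/br_comm.
have := all2_iota transverse_reach ha hb'; rewrite /reach_check (negPf nt).
rewrite leqNgt hb ltnNge a12 => /hasP[n _].
case: ifP => // /andP[na nb] /hasP[m _]; case: ifP => // ma mb.
by apply: (ee_transfer na nb); apply: (ee_transfer ma mb).
Qed.

Lemma ee_expand (H1 H2 : hyperplanes W) : H1 <> H2 -> exists l : seq refls,
  br_e H1 * br_e H2 = \sum_(s <- l) mu s *: (br_w (val s) * br_e H2).
Proof.
have [i hi ->] := hyp_hy H1; have [j hj ->] := hyp_hy H2 => ne.
have ij : i != j by apply: contra_notN ne => /eqP ->.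
have [nt|nt] := boolP (nontransverse i j).
  by exists (map rf (refl_from_to j i)); rewrite big_map (ee_sum hi hj nt).
exists [::]; rewrite big_nil; apply: ee_zero => //.
by have := all2_iota nontransverse_same hi hj; rewrite (negPf ij) (negPf nt) /= orbF.
Qed.

End Relations.

(** * The generators of G_26 *)

Definition mirror_order (i : nat) : nat := if (i < 12)%N then 3%N else 2%N.

Lemma rdat_order : all (fun s : nat * ei =>
  let w := s.2 in let w2 := ei_mul w w in
  ~~ ei_eq w (ei_root 0) &&
  if (s.1 < 12)%N then ~~ ei_eq w2 (ei_root 0) && ei_eq (ei_mul w w2) (ei_root 0)
  else ei_eq w2 (ei_root 0)) refl_data.
Proof. by vm_compute. Qed.

Lemma rdat_complete : all (fun i =>
  if (i < 12)%N then
    has (fun n => ((rdat n).1 == i) && ei_eq (rdat n).2 (ei_root 1)) (iota 0 33)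
    && has (fun n => ((rdat n).1 == i) && ei_eq (rdat n).2 (ei_root 2)) (iota 0 33)
  else has (fun n => ((rdat n).1 == i) && ei_eq (rdat n).2 ei_m1) (iota 0 33))
  (iota 0 21).
Proof. by vm_compute. Qed.

Section Generators.
Variables (C : numClosedFieldType) (z : C).
Hypothesis hz : z ^+ 2 + z + 1 = 0.
Implicit Types (g : 'M[C]_3).
Local Notation cv := (cv z).
Local Notation ce := (ce z).
Local Notation rmat := (refl_mx z).
Local Notation hform := (mirror z).

Lemma rw_expn (a : 'rV[C]_3) w k : a != 0 -> rw a w ^+ k = rw a (w ^+ k).
Proof.
move=> a0; elim: k => [|k IH]; first by rewrite !expr0 rw1.
by rewrite exprS IH -[_ * _]/(rw a w *m rw a (w ^+ k)) rwM // -exprS.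
Qed.

Lemma rw_eq1 (a : 'rV[C]_3) w : a != 0 -> rw a w = 1 -> w = 1.
Proof. by move=> a0 e; apply: (rw_inj a0); rewrite rw1 e. Qed.

Lemma ce1 : ce (ei_root 0) = 1.
Proof. by rewrite (ce_root hz (k := 0)). Qed.

Lemma rmat_order n : let m := mirror_order (rdat n).1 in
  [/\ (0 < m)%N, rmat n ^+ m = 1 & forall k, (0 < k < m)%N -> rmat n ^+ k <> 1].
Proof.
have a0 := cv_root_neq0 hz (rdat n).1; have := rdat_all rdat_order n.
rewrite /mirror_order /refl_mx; set w := (rdat n).2.
rewrite !(ei_eqE hz) !(ceM hz) ce1 => /andP[w1].
case: ifP => _ => [/andP[w2 /eqP w3]|/eqP w2]; split=> //.
- by rewrite rw_expn // exprS expr2 w3 rw1.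
- case=> [|[|[|k]]] // _; rewrite rw_expn // => /(rw_eq1 a0)/eqP;
    by rewrite ?expr1 ?expr2 ?(negPf w1) ?(negPf w2).
- by rewrite rw_expn // expr2 w2 rw1.
- by case=> [|[|k]] // _; rewrite rw_expn // => /(rw_eq1 a0)/eqP; rewrite expr1 (negPf w1).
Qed.

(** A unitary map with this fixed space is determined by its eigenvalue, a nontrivial root of unity
    of order dividing 2 or 3: it is [-1], [zeta] or [zeta^2]. *)
Lemma generator_rmat i g : (i < 21)%N -> g \is unitarymx -> ker1 g = hform i ->
  g ^+ mirror_order i = 1 -> g <> 1 -> exists n, g = rmat n.
Proof.
move=> hi ug kg gm g1; have a0 := cv_root_neq0 hz i.
have [w gE] : exists w, g = rw (cv (mroot i)) w.
  by apply: unitary_rw => //; apply: fker_sub_ker1; rewrite kg.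
have w1 : w != 1 by apply/eqP => w1; apply: g1; rewrite gE w1 rw1.
have wm : w ^+ mirror_order i = 1 by apply: (rw_eq1 a0); rewrite -rw_expn // -gE.
have found u : has (fun n => ((rdat n).1 == i) && ei_eq (rdat n).2 u) (iota 0 33) ->
    w = ce u -> exists n, g = rmat n.
  case/hasP => n _ /andP[/eqP e]; rewrite (ei_eqE hz) => /eqP e' wu.
  by exists n; rewrite gE wu -e' -e.
have := allP rdat_complete i; rewrite mem_iota => /(_ hi).
move: wm; rewrite /mirror_order; case: ifP => _ wm.
  case/andP => h1 h2; have := subrr (1 : C); rewrite -{1}wm => /eqP.
  have -> : w ^+ 3 - 1 = (w - 1) * ((w - z) * (w - z ^+ 2)).
    have -> : w ^+ 3 - 1 = (w - 1) * (w ^+ 2 + w + 1) by ring.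
    congr (_ * _).
    have -> : (w - z) * (w - z ^+ 2) = w ^+ 2 - (z ^+ 2 + z + 1) * w + w + z ^+ 3.
      by ring.
    by rewrite hz mul0r subr0 (z3 hz).
  rewrite !mulf_eq0 !subr_eq0 (negPf w1) /= => /orP[] /eqP e.
    by apply: found h1 _; rewrite (ce_root hz) // expr1.
  by apply: found h2 _; rewrite (ce_root hz).
move=> h; apply: found h _; have /eqP := subrr (1 : C); rewrite -{1}wm.
rewrite subr_sqr_1 mulf_eq0 subr_eq0 (negPf w1) /= addr_eq0 => /eqP ->.
by rewrite ceN ce1.
Qed.

Lemma cv_unit (i : 'I_3) : cv (ev_unit i) = delta_mx 0 i.
Proof.
apply/rowP => j; rewrite !mxE eqxx /= /ev_unit.
have -> : ev_coord (ev_of (fun j0 => ei_int (BinInt.Z.of_nat (i == j0 :> nat)))) j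
   = ei_int (BinInt.Z.of_nat (i == j :> nat)) by case: j => [[|[|[|]]] // ?].
rewrite [j == i]eq_sym -val_eqE /=; case: eqP => _ /=; last exact: ce0.
exact: ce1.
Qed.

Lemma cv_mroot_unit (i : 'I_3) : cv (mroot i) = delta_mx 0 i.
Proof. by rewrite -cv_unit; case: i => [[|[|[|]]] // ?]. Qed.

Lemma cv_mroot_sum (k l : 'I_3) :
  cv (mroot (3 + (k * 3 + l))) = \row_j [:: 1; z ^+ k; z ^+ l]`_j.
Proof.
have -> : mroot (3 + (k * 3 + l)) = ev_sum k l.
  by case: k l => [[|[|[|]]] // ?] [[|[|[|]]] // ?].
apply/rowP => -[[|[|[|]]] // i]; rewrite !mxE.
- exact: ce1.
- exact: (ce_root hz (ltn_ord k)).
- exact: (ce_root hz (ltn_ord l)).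
Qed.

Lemma cv_diff (i j k : 'I_3) :
  cv (ev_diff i j k) = delta_mx 0 i - z ^+ k *: delta_mx 0 j.
Proof. by rewrite (cvB hz) (cvZ hz) !cv_unit (ce_root hz). Qed.

(** Exchanging [i] and [j] and inverting [zeta^k] gives a proportional form, so the 18 triples yield
    9 mirrors. *)
Lemma diff_mirror (i j k : 'I_3) : i != j -> exists2 n, (n < 9)%N &
  fker (delta_mx 0 i - z ^+ k *: delta_mx 0 j) = hform (12 + n).
Proof.
move=> ij; pose f n := ev_par (mroot (12 + n)) (ev_diff i j k)
           && ~~ ev_eq (ev_diff i j k) ev_zero.
have /hasP[n] : has f (iota 0 9).
  rewrite /f; case: i j k ij {f} => [[|[|[|]]] // ?] [[|[|[|]]] // ?] [[|[|[|]]] // ?] _;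
    by vm_compute.
rewrite mem_iota => /andP[_ hn] /andP[/(ev_parP hz _ (root_neq0 _))[c e]].
rewrite (ev_eqE hz) e (cv0 z) scaler_eq0 negb_or => /andP[c0 _].
by exists n => //; rewrite -cv_diff e fkerZ.
Qed.

Lemma mirror_diff_index n : (12 <= n < 21)%N -> exists i j k : 'I_3, i != j /\
  cv (mroot n) = delta_mx 0 i - z ^+ k *: delta_mx 0 j.
Proof.
move=> hn; suff [i [j [k [ij e]]]] : exists i j k : 'I_3, i != j /\ mroot n = ev_diff i j k.
  by exists i, j, k; split=> //; rewrite e cv_diff.
pose o0 : 'I_3 := @Ordinal 3 0 isT; pose o1 : 'I_3 := @Ordinal 3 1 isT.
pose o2 : 'I_3 := @Ordinal 3 2 isT.
case/andP: hn => h1 h2; rewrite -(subnKC h1); have : (n - 12 < 9)%N by rewrite ltn_subLR.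
case: (n - 12)%N => [|[|[|[|[|[|[|[|[|]]]]]]]]] // _.
- by exists o0, o1, o0.
- by exists o0, o1, o1.
- by exists o0, o1, o2.
- by exists o0, o2, o0.
- by exists o0, o2, o1.
- by exists o0, o2, o2.
- by exists o1, o2, o0.
- by exists o1, o2, o1.
- by exists o1, o2, o2.
Qed.

End Generators.

Section Final.
Variable R : realType.
Local Notation C := R[i].
Local Notation z := (zeta R).

Lemma zeta_root : z ^+ 2 + z + 1 = 0.
Proof.
pose t : R := 2 * pi / 3; pose cis (x : R) : C := (cos x +i* sin x)%C.
have cisD x y : cis x * cis y = cis (x + y).
  by rewrite /cis cosD sinD; apply/eqP; rewrite eq_complex /= eqxx /= addrC [X in _ + X]mulrC.
have zE : z = cis t by [].
have z3 : z ^+ 3 = 1.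
  rewrite !exprS expr0 mulr1 zE !cisD /cis.
  have -> : t + (t + t) = pi *+ 2 by rewrite /t; field.
  by rewrite cos2pi sin2pi.
have pi0 : 0 < pi :> R := pi_gt0 R.
(* The imaginary part is positive, the angle being strictly between 0 and [pi]; so [z] is a cube
   root of unity other than 1. *)
have z1 : z - 1 != 0.
  rewrite subr_eq0 zE /cis eq_complex /= negb_and orbC gt_eqF //.
  by apply: sin_gt0_pi; rewrite /t; apply/andP; split; lra.
apply: (mulfI z1); rewrite mulr0 -(subrr 1) -{3}z3; ring.
Qed.

Lemma mirrorP m H : G26_mirror (R := R) m H ->
  exists2 i, (i < 21)%N & H = mirror z i /\ m = mirror_order i.
Proof.
case=> [i|k l|i j k ij].
- exists i; first exact: leq_trans (ltn_ord i) _.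
  split; first exact: (congr1 (@form_ker R) (esym (cv_mroot_unit zeta_root i))).
  by rewrite /mirror_order (leq_trans (ltn_ord i)).
- exists (3 + (k * 3 + l))%N; first by case: k l => [[|[|[|]]] // ?] [[|[|[|]]] // ?].
  split; first exact: (congr1 (@form_ker R) (esym (cv_mroot_sum zeta_root k l))).
  by case: k l => [[|[|[|]]] // ?] [[|[|[|]]] // ?].
- have [n hn e] := diff_mirror zeta_root k ij.
  exists (12 + n)%N; first by rewrite (ltn_add2l 12 n 9).
  by split; [exact: e|rewrite /mirror_order ltnNge leq_addr].
Qed.

Lemma mirror_hform i : (i < 21)%N -> G26_mirror (R := R) (mirror_order i) (mirror z i).
Proof.
move=> hi; rewrite /mirror_order; have [i12|i12] := ltnP i 12; last first.
  have [j [k [l [jk e]]]] := mirror_diff_index zeta_root (n := i) (introT andP (conj i12 hi)).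
  by rewrite /mirror e; exact: mirror_diff.
have [i3|i3] := ltnP i 3.
  by have := cv_mroot_unit zeta_root (Ordinal i3); rewrite /mirror /= => ->; exact: mirror_coord.
have hk : ((i - 3) %/ 3 < 3)%N by rewrite ltn_divLR // ltn_subLR.
have hl : ((i - 3) %% 3 < 3)%N by rewrite ltn_mod.
have e3 : (3 + ((i - 3) %/ 3 * 3 + (i - 3) %% 3) = i)%N by rewrite -divn_eq subnKC.
have e : form_ker (cv z (mroot i)) = form_ker (\row_j [:: 1; z ^+ Ordinal hk; z ^+ Ordinal hl]`_j).
  rewrite -[in LHS]e3.
  exact: (congr1 (@form_ker R) (cv_mroot_sum zeta_root (Ordinal hk) (Ordinal hl))).
by rewrite -[mirror z i]/(form_ker (cv z (mroot i))) e; exact: mirror_sum.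
Qed.

Lemma G26_rmat n : G26 R (refl_mx z n).
Proof.
have [m0 m1 mk] := rmat_order zeta_root n.
apply: (G26_gen (mirror_hform (rdat_lt n))); split.
- exact: (rmat_unitary zeta_root).
- exact: (rmat_reflection zeta_root).
- exact: (ker1_rmat zeta_root).
- by split.
Qed.

(** The defining generators are given by order and mirror; [generator_rmat] identifies each with a
    listed reflection. *)
Lemma G26_ind_rmat (P : set 'M[C]_3) : P 1%:M -> (forall n, P (refl_mx z n)) ->
  (forall g h, G26 R g -> G26 R h -> P g -> P h -> P (g *m h)) ->
  (forall g, G26 R g -> P g -> P (invmx g)) -> forall g, G26 R g -> P g.
Proof.
move=> P1 Pr PM PV g; elim=> {g}.
- move=> m H g /mirrorP[i hi [-> ->]] [ug _ kg [_ gm gk]].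
  have g1 : g <> 1 by apply: (gk 1%N); rewrite /mirror_order; case: ifP.
  by have [n ->] := generator_rmat zeta_root hi ug kg gm g1; exact: Pr.
- exact: P1.
- by move=> g h Gg Pg Gh Ph; exact: PM.
- by move=> g Gg Pg; exact: PV.
Qed.

End Final.

Theorem proposition7p16 (R : realType)
    (T : hyperplanes (G26 R) -> set (set_type (G26 R)))
    (hT : forall H : hyperplanes (G26 R), left_transversal (ptstab H) (T H)) :
  is_basis (br_family (T := T)).
Proof.
have hz := zeta_root R; have W1 := G26_1 R; have WM := @G26_M R; have WV := @G26_V R.
have Wgen := @G26_rmat R; have Wind := @G26_ind_rmat R.
have WU g : G26 R g -> g \in unitmx by exact: (W_unit hz Wind).
split.
  apply: (br_family_spans WU W1 WM WV hT).
  exact: (ee_expand hz W1 WM WV Wgen Wind).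
have [eW eWu eWP] := W_finite hz Wind.
pose lR := undup [seq rf hz Wgen n | n <- iota 0 33].
have lRP s : s \in lR.
  by have [n hn ->] := refl_rf hz Wgen Wind s; rewrite mem_undup map_f // mem_iota.
exact: (br_family_free WU W1 WM WV eWu eWP (undup_uniq _) lRP hT).
Qed.
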